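(* Let $F$ be a field with $\operatorname{char}F\neq 2$. The following are equivalent: (1) there is a Galois extension $K/F$ with $\operatorname{Gal}(K/F)\cong D\curlywedge C$; (2) there is a Galois extension $L/F$ with $\operatorname{Gal}(L/F)\cong G_1$; (3) there exist $a,b\in F$ with $[F(\sqrt a,\sqrt b):F]=4$ and $(a,a)_F=(a,b)_F=0$ in the Brauer group $Br(F)$; (4) there exists $a\in D_F(\langle 1,1\rangle)\setminus\dot F^2$ such that $D_F(\langle 1,-a\rangle)$ contains at least $4$ square classes, i.e. $|D_F(\langle1,-a\rangle)/\dot F^2|\ge 4$; (5) $F$ is not rigid and $D_F(\langle1,1\rangle)\not\subseteq F^2\cup -F^2$; (6) either $-1\in F^2$ and $F$ is not rigid, or $-1\notin F^2$ and $D_F(\langle1,1\rangle)\not\subseteq F^2\cup -F^2$. Moreover, if $F$ is formally real, then (1)–(6) hold if and only if $F$ is not a Pythagorean field.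
   Context: $\dot F=F\setminus\{0\}$; $D_F(q)$ is the set of elements of $\dot F$ represented by a quadratic form $q$; $\langle a_1,a_2\rangle$ is $a_1x_1^2+a_2x_2^2$. An element $c\in\dot F\setminus(F^2\cup-F^2)$ is rigid if $D_F(\langle1,c\rangle)=\dot F^2\cup c\dot F^2$; $F$ is rigid if every such $c$ is rigid. $(a,b)_F$ denotes the class of the quaternion algebra in $Br(F)$. $D$ is the dihedral group of order 8, $C$ the cyclic group of order 4. $D\curlywedge C$ is the pullback of $\lambda:D\to\mathbb Z/2\mathbb Z$ (a homomorphism with kernel isomorphic to $\mathbb Z/2\times\mathbb Z/2$) and the nontrivial homomorphism $\eta:C\to\mathbb Z/2\mathbb Z$, i.e. $\{(u,v)\in D\times C:\lambda(u)=\eta(v)\}$, a group of order 16. Commutators $[\sigma,\tau]=\sigma^{-1}\tau^{-1}\sigma\tau$. $G_1$ is the group generated by $x,y$ with relations $x^4=y^2=1$, $[x,y]^2=1$, $[[x,y],x]^2=1$, and $[[x,y],x]$ commutes with $x$ and $y$. *)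

(* Defs.v *)
From HB Require Import structures.
From mathcomp Require Import all_boot all_order all_algebra all_fingroup all_solvable all_field.
Set Implicit Arguments. Unset Strict Implicit. Unset Printing Implicit Defensive.
Import GRing.Theory.
Local Open Scope ring_scope.

Definition is_sq (F : fieldType) (x : F) : Prop := exists t : F, x = t ^+ 2.

Definition DF2 (F : fieldType) (c x : F) : Prop :=
  x != 0 /\ exists u v : F, x = u ^+ 2 + c * v ^+ 2.

Definition same_sqclass (F : fieldType) (x y : F) : Prop :=
  exists t : F, t != 0 /\ x = t ^+ 2 * y.

Definition rigid_elt (F : fieldType) (c : F) : Prop :=
  forall x : F, DF2 c x <-> exists t : F, t != 0 /\ (x = t ^+ 2 \/ x = c * t ^+ 2).

Definition rigid_field (F : fieldType) : Prop :=
  forall c : F, c != 0 -> ~ is_sq c -> ~ is_sq (- c) -> rigid_elt c.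

Definition formally_real (F : fieldType) : Prop :=
  ~ exists (n : nat) (s : 'I_n -> F), \sum_(i < n) s i ^+ 2 = -1.

Definition pythagorean (F : fieldType) : Prop :=
  forall x y : F, is_sq (x ^+ 2 + y ^+ 2).

(* [F(sqrt a, sqrt b) : F] = 4, computed in some extension of F containing
   square roots of a and b (the degree does not depend on that choice) *)
Definition biquadratic_deg4 (F : fieldType) (a b : F) : Prop :=
  exists (L : fieldExtType F) (x y : L),
    x ^+ 2 = a%:A /\ y ^+ 2 = b%:A /\ \dim <<1 & [:: x; y]>>%VS = 4%N.

(* (a,b)_F = 0 in Br(F), i.e. the quaternion algebra (a,b)_F (generated by
   i, j with i^2 = a, j^2 = b, ij = -ji) is split, i.e. isomorphic to M_2(F);
   since (a,b)_F is central simple of dimension 4, this is the same as the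
   existence of an F-algebra map (a,b)_F -> M_2(F), i.e. of the images I, J. *)
Definition quat_split (F : fieldType) (a b : F) : Prop :=
  exists I J : 'M[F]_2,
    I *m I = a%:M /\ J *m J = b%:M /\ I *m J = - (J *m I).

Local Open Scope group_scope.

Definition eta4 (v : 'Z_4) : 'Z_2 := inZp (nat_of_ord v).

Definition DC_pullback (lam : {morphism [set: 'D_8] >-> 'Z_2}) : {set ('D_8 * 'Z_4)} :=
  [set uv : 'D_8 * 'Z_4 | lam uv.1 == eta4 uv.2].

Definition isog_DC (gT : finGroupType) (H : {set gT}) : Prop :=
  exists lam : {morphism [set: 'D_8] >-> 'Z_2},
    'ker lam \isog [set: 'Z_2 * 'Z_2] /\ H \isog DC_pullback lam.

Definition isog_G1 (gT : finGroupType) (H : {group gT}) : Prop :=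
  H \isog Grp (x : y : (x ^+ 4, y ^+ 2, [~ x, y] ^+ 2, [~ x, y, x] ^+ 2,
                        [~ x, y, x] * x = x * [~ x, y, x],
                        [~ x, y, x] * y = y * [~ x, y, x])).

(* Main.v *)
(* Fix [a], [b] with [a = i^2 - a j^2] and [a = g^2 - b h^2], i.e. with (a, a) and
   (a, b) split, and put [p = i - g j], which is nonzero for one choice of the
   sign of [g].  With [al = sqrt a] and [de = sqrt (2 p (i + al))], the field
   F(de) is cyclic of degree 4 over F and contains [mu = p + al + de], whose norm
   to F(al) is [b (h j)^2].  So if [x] is an automorphism with [x al = - al], the
   roots [r_k = x^k (sqrt mu)] satisfy [r_0 r_2 = h j sqrt b] up to sign and [x]
   permutes them cyclically, while the automorphisms fixing [de] change an even
   number of signs of the [r_k]: the Galois group of F(r_0, ..., r_3) is the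
   extension of the cyclic group <x> by the even sign changes, which is [G1].
   The pullback of D and C is a quotient of [G1].  Conversely, in an extension
   whose group is that pullback, an element [B] with [x^2 B = - B] gives
   [(B x(B))^2 = p^2 - a q^2], a norm equation for [a], resp. for [a b].  The
   remaining equivalences compare square classes in the group of norms from
   F(sqrt a). *)
Require Import Defs.
From HB Require Import structures.
From mathcomp Require Import all_boot all_order all_algebra all_fingroup all_solvable all_field.
From mathcomp Require Import ring.
From Stdlib Require Import Classical.
Import GRing.Theory.
Local Open Scope ring_scope.

Set Implicit Arguments. Unset Strict Implicit. Unset Printing Implicit Defensive.

(** * Split quaternion algebras, norms from F(sqrt a) and sums of two squares *)

Section SquareClasses.
Variable F : fieldType.
Implicit Types a b c x y : F.

(** The algebra acts on [F[t]/(t^2 - a)] with basis 1, t: [I] is multiplication by t, and [J] is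
    conjugation followed by multiplication by [m + n t], whose square is the norm [b]. *)
Lemma quat_split_norm a b m n : b = m ^+ 2 - a * n ^+ 2 -> quat_split a b.
Proof.
pose mx2 (p q r s : F) : 'M_2 :=
  \matrix_(i, j) if i == 0 then (if j == 0 then p else q)
                 else (if j == 0 then r else s).
move=> ->; exists (mx2 0 a 1 0), (mx2 m (- a * n) n (- m)).
split; [|split]; apply/matrixP=> -[[|[|//]] ?] [[|[|//]] ?];
  rewrite !mxE !big_ord_recl ?big_ord0 !mxE /=; ring.
Qed.

(* The first row [e] of the identity and [e *m I] span the plane, since [a] is
   not a square; [m] and [n] are the coordinates of [e *m J]. *)
Lemma quat_split_isnorm a b : ~ is_sq a -> quat_split a b ->
  exists m n, b = m ^+ 2 - a * n ^+ 2.
Proof.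
move=> nsa [I [J [II [JJ IJ]]]].
pose entry i j (M : 'M[F]_2) := M i j.
move: (congr1 (entry 0 0) II) (congr1 (entry 0 0) JJ) (congr1 (entry 0 0) IJ).
rewrite /entry /=.
rewrite !mxE !big_ord_recl !big_ord0 /= !addr0.
have -> : lift ord0 ord0 = 1 :> 'I_2 by apply: val_inj.
have -> : ord0 = 0 :> 'I_2 by apply: val_inj.
move: (I 0 0) (I 0 1) (I 1 0) (J 0 0) (J 0 1) (J 1 0) => p q r P Q R.
rewrite !mulr1n => e1 e3 e4.
have q0 : q != 0.
  apply/eqP=> q0; case: nsa; exists p.
  by rewrite -e1 q0 mul0r addr0 expr2.
have e5 : q * R = - (P * p + Q * r) - p * P.
  by rewrite -e4 addrC addKr.
exists (P - p * Q / q), (Q / q); rewrite -e1 -e3.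
have -> : R = (- (P * p + Q * r) - p * P) / q by rewrite -e5 mulrC mulKf.
by field.
Qed.

Lemma quat_split_sym a b : quat_split a b -> quat_split b a.
Proof. by case=> I [J [? [? IJ]]]; exists J, I; rewrite IJ opprK. Qed.

Lemma DF2_norm_mul a x y : DF2 (- a) x -> DF2 (- a) y -> DF2 (- a) (x * y).
Proof.
move=> [x0 [u [v ex]]] [y0 [s [t ey]]]; split; first by rewrite mulf_neq0.
(* Coordinates of the product of [u + v sqrt a] and [s + t sqrt a]. *)
by exists (u * s + a * v * t), (u * t + v * s); rewrite ex ey; ring.
Qed.

(** From [a = u^2 + v^2] follows [a v^2 = a^2 - a u^2]; division by [v^2] exhibits [a] as a norm. *)
Lemma sum_two_squares_norm a : ~ is_sq a -> DF2 1 a -> DF2 (- a) a.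
Proof.
move=> nsa [a0 [u [v ea]]]; split=> //.
have v0 : v != 0.
  by apply/eqP=> v0; case: nsa; exists u; rewrite ea v0; ring.
have ev : a - u ^+ 2 = v ^+ 2 by rewrite {1}ea; ring.
exists (a / v), (u / v); transitivity (a * (a - u ^+ 2) / v ^+ 2); last by field.
by rewrite ev mulfK // expf_neq0.
Qed.
End SquareClasses.
(** * Splitting fields *)

(** Moves the roots into the field they generate, taken as an extension of [F] in its own right. It
    serves both to cut a splitting field out of a larger extension and to turn a Galois subfield
    into a splitting field. *)
Lemma subvs_splitting_field (F : fieldType) (L : fieldExtType F) (p : {poly F})
    (rs : seq L) :
    map_poly (in_alg L) p %= \prod_(r <- rs) ('X - r%:P) ->
  exists zs : seq (subvs_of <<1 & rs>>),
    [/\ map_poly (in_alg _) p %= \prod_(z <- zs) ('X - z%:P),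
        (<<1 & zs>> = fullv)%VS & map vsval zs = rs].
Proof.
move=> Dp; set E := <<1 & rs>>%AS.
pose i := linfun (vsval : subvs_of E -> L).
have iE : i =1 vsval by move=> u; rewrite lfunE.
pose zs := map (vsproj E) rs.
have izs : map i zs = rs.
  rewrite -map_comp map_id_in // => r rs_r /=.
  by rewrite iE vsprojK // seqv_sub_adjoin.
exists zs; split.
- rewrite -(eqp_map i) rmorph_prod /= (eq_bigr (fun z => 'X - (i z)%:P)); last first.
    by move=> z _; rewrite map_polyXsubC.
  rewrite -(big_map i xpredT (fun r => 'X - r%:P)) izs -map_poly_comp.
  rewrite (_ : map_poly _ p = map_poly (in_alg L) p) //.
  by apply: eq_map_poly => x; apply: rmorph_alg.
- apply/vspaceP=> u; rewrite memvf.
  have: i u \in (i @: <<1 & zs>>)%VS.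
    by rewrite aimg_adjoin_seq aimg1 izs iE (valP u).
  by case/memv_imgP=> v zs_v; rewrite !iE => /val_inj->.
- by rewrite -[RHS]izs; apply: eq_map => z; rewrite iE.
Qed.

Lemma irreducible_factor (F : fieldType) (p : {poly F}) :
  (1 < size p)%N -> exists2 q, irreducible_poly q & q %| p.
Proof.
have [n] := ubnP (size p); elim: n p => // n IHn p ltpn p1.
case: (classic (irreducible_poly p)) => [irr|]; first by exists p.
move=> nirr; have [q [q1 [qp nqp]]] :
    exists q : {poly F}, size q != 1%N /\ (q %| p /\ ~ q %= p).
  apply: NNPP => nq; apply: nirr; split=> // q q1 qp.
  by apply: NNPP => nqp; apply: nq; exists q.
have p0 : p != 0 by rewrite -size_poly_gt0 ltnW.
have q0 : q != 0 by apply: dvdpN0 qp p0.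
have [||r irr rq] := IHn q.
- apply: leq_trans (_ : size p <= n)%N => //.
  rewrite ltn_neqAle dvdp_leq // andbT; apply/negP=> /eqP e.
  by apply: nqp; rewrite -dvdp_size_eqp // e.
- by rewrite ltn_neqAle eq_sym q1 size_poly_gt0.
by exists r => //; apply: dvdp_trans rq qp.
Qed.

(** The base field varies in the induction: adjoin a root [x] of an irreducible factor, split the
    cofactor of ['X - x] over the new field [K], and regard the result as an extension of [F]. *)
Lemma splitting_extension_exists (F : fieldType) (p : {poly F}) : p != 0 ->
  exists (L : fieldExtType F) (rs : seq L),
    map_poly (in_alg L) p %= \prod_(r <- rs) ('X - r%:P).
Proof.
have [n] := ubnP (size p); elim: n F p => // n IHn F p ltpn p0.
have [p1|p1] := leqP (size p) 1.
  exists F^o, [::]; rewrite big_nil -size_poly_eq1 size_map_poly.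
  by rewrite eqn_leq p1 size_poly_gt0.
have [q irr qp] := irreducible_factor p1.
have [K _ [x qx _]] := irredp_FAdjoin irr.
have : root (map_poly (in_alg K) p) x by rewrite -(divpK qp) rmorphM rootM qx orbT.
case/factor_theorem=> r Dr.
have szr : size p = size (r * ('X - x%:P)) by rewrite -Dr size_map_poly.
have r0 : r != 0.
  by move: p0; rewrite -size_poly_eq0 szr size_poly_eq0 mulf_eq0 => /norP[].
have ltrn : (size r < n)%N.
  by rewrite szr size_mul ?polyXsubC_eq0 // size_XsubC addn2 in ltpn.
have [L [zs Dz]] := IHn K r ltrn r0.
exists (baseFieldType L), (x%:A :: zs).
have -> : map_poly (in_alg (baseFieldType L)) p =
          map_poly (in_alg L) (map_poly (in_alg K) p).
  rewrite -map_poly_comp; apply: eq_map_poly => a.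
  exact: (@baseField_scaleE F K L a 1).
by rewrite big_cons Dr mulrC rmorphM /= map_polyXsubC /= eqp_mull.
Qed.

Lemma splitting_field_exists (F : fieldType) (p : {poly F}) : p != 0 ->
  exists L : splittingFieldType F,
    splittingFieldFor 1 (map_poly (in_alg L) p) {:L}.
Proof.
case/splitting_extension_exists=> L [rs /subvs_splitting_field[zs [Dp gen _]]].
set E := subvs_of _ in zs Dp gen *.
have ax : splitting_field_axiom E.
  by exists (map_poly (in_alg E) p); [apply: alg_polyOver | exists zs].
by exists (HB.pack_for (splittingFieldType F) E
           (FieldExt_isSplittingField.Build F E ax)), zs.
Qed.

(** * Quotients of a Galois group realised by subextensions *)

Section GaloisQuotient.
Variables (F : fieldType) (L : splittingFieldType F).
Hypothesis galL : galois 1 {:L}.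

Section Restriction.
Variable E : {subfield L}.
Hypothesis galE : galois 1 E.

Lemma gal_stable (g : gal_of {:L}) u : u \in E -> g u \in E.
Proof.
move=> Eu; case/and3P: galE => _ _ /forall_inP/(_ (g : 'AEnd(L))).
rewrite inE kAutfE k1AHom => /(_ isT)/eqP e.
by move: (memv_img (g : 'End(L)) Eu); rewrite e.
Qed.

Definition restr_lfun (g : gal_of {:L}) : 'End(subvs_of E) :=
  (linfun (vsproj E) \o g \o linfun (vsval : subvs_of E -> L))%VF.

Lemma restr_lfunE g u : vsval (restr_lfun g u) = g (vsval u).
Proof.
have iE : linfun (vsval : subvs_of E -> L) u = vsval u by rewrite lfunE.
rewrite !lfunE /= lfunE /= lfunE /= iE vsprojK //.
by apply: gal_stable; apply: valP.
Qed.

Lemma restr_ahom g : ahom_in fullv (restr_lfun g).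
Proof.
apply/ahomP_tmp; split=> [|u v]; apply: val_inj => /=.
  by rewrite restr_lfunE /= algid1 rmorph1.
by rewrite !restr_lfunE -rmorphM.
Qed.
End Restriction.

(** Restriction of automorphisms to [E] is a morphism with kernel ['Gal({:L} / E)]; the field [L']
    is [subvs_of E]. *)
Lemma galois_subextension (E : {subfield L}) : galois 1 E ->
  exists L' : splittingFieldType F, galois 1 {:L'} /\
    'Gal({:L} / 1) / 'Gal({:L} / E) \isog 'Gal({:L'} / 1).
Proof.
move=> galE; have [p [/polyOver1P[q Dp] sepp [rs Dpr genE]]] :=
  splitting_galoisField galE.
rewrite {}Dp in sepp Dpr; have Er : E = <<1 & rs>>%AS by apply: val_inj.
subst E; have [zs [Dz genz _]] := subvs_splitting_field Dpr.
set E := <<1 & rs>>%AS in galE *; set T := subvs_of E.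
have ax : splitting_field_axiom T.
  by exists (map_poly (in_alg T) q); [apply: alg_polyOver | exists zs].
pose L' := HB.pack_for (splittingFieldType F) T
             (FieldExt_isSplittingField.Build F T ax).
have galL' : galois 1 {:L'}.
  apply/splitting_galoisField; exists (map_poly (in_alg L') q); split.
  - exact: alg_polyOver.
  - by rewrite separable_map -(separable_map (in_alg L)).
  - by exists zs.
exists L'; split=> //.
pose res (g : gal_of {:L}) := gal {:L'} (AHom (restr_ahom galE g) : 'AEnd(L')).
have resE g (u : L') : vsval (res g u : T) = g (vsval (u : T)).
  by rewrite /res galK ?memvf ?subvf //; apply: restr_lfunE.
have resM : {in 'Gal({:L} / 1)%g &, {morph res : g h / (g * h)%g}}.
  move=> g h _ _; apply/eqP/gal_eqP=> u _; apply: val_inj.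
  by rewrite /= resE !galM ?memvf // !resE.
pose f := Morphism resM.
have kerf : ('ker f = 'Gal({:L} / E))%g.
  apply/setP=> g; apply/idP/idP=> [kg | Eg].
    rewrite gal_kHom ?subvf //; apply/kAHomP=> a Ea.
    have /(congr1 (fun h : gal_of {:L'} => vsval (h (Subvs Ea) : T))) := mker kg.
    by rewrite /= resE gal_id.
  apply/kerP; first exact: (subsetP (galS _ (sub1v E))).
  apply/eqP/gal_eqP=> u _; apply: val_inj.
  by rewrite /= resE gal_id (fixed_gal (subvf _) Eg) // (valP u).
have imf : (f @* 'Gal({:L} / 1) = 'Gal({:L'} / 1))%g.
  apply/eqP; rewrite eqEcard; apply/andP; split.
    by apply/subsetP=> h _; rewrite gal_kHom ?sub1v ?k1AHom.
  (* Surjectivity by counting: the image and ['Gal({:L'} / 1)] both have order the degree of [E]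
     over [F]. *)
  have nE : normalField 1 E by case/and3P: (galE).
  rewrite -(card_isog (first_isog f)) kerf.
  rewrite (card_isog (normalField_isog galL _ nE)) ?sub1v ?subvf //.
  by rewrite -!galois_dim // !dimv1 !divn1 dimvf leqnn.
by rewrite -kerf -imf; apply: first_isog.
Qed.

(** The fixed field of the kernel of the surjection onto [H] is Galois over [F], with group the
    image. *)
Lemma galois_quotient (gT : finGroupType) (H : {group gT}) :
    (H \homg 'Gal({:L} / 1))%g ->
  exists L' : splittingFieldType F, galois 1 {:L'} /\ ('Gal({:L'} / 1) \isog H)%g.
Proof.
case/homgP=> f imf.
have galE := normal_fixedField_galois galL (ker_normal f).
have [L' [galL' iso]] := galois_subextension galE; exists L'; split=> //.
rewrite gal_fixedField in iso; rewrite isog_sym in iso.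
by apply: isog_trans iso _; rewrite -imf; apply: first_isog.
Qed.
End GaloisQuotient.

(** * The group [G1] and the pullback of D and C *)

Section GroupG1.
Local Open Scope nat_scope.
Local Open Scope group_scope.

Definition G1_rel (gT : finGroupType) (x y : gT) : Prop :=
  [/\ x ^+ 4 = 1, y ^+ 2 = 1, [~ x, y] ^+ 2 = 1, [~ x, y, x] ^+ 2 = 1
    & commute [~ x, y, x] x /\ commute [~ x, y, x] y].

Lemma leq_card_mulg (gT : finGroupType) (A B : {group gT}) :
  #|A * B| <= #|A| * #|B|.
Proof. by rewrite mul_cardG leq_pmulr ?cardG_gt0. Qed.

Lemma order_leq (gT : finGroupType) (x : gT) n : x ^+ n.+1 = 1 -> #[x] <= n.+1.
Proof. by move/eqP; rewrite -order_dvdn; apply: dvdn_leq. Qed.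

(** [[~ x, y]] is the product of [y ^ x] and [y], both of trivial square, so conjugation by [y]
    inverts it; being of trivial square, it is its own inverse. *)
Lemma commg_invol (gT : finGroupType) (x y : gT) : y ^+ 2 = 1 ->
  [~ x, y] ^+ 2 = 1 -> y ^ x = [~ x, y] * y /\ [~ x, y] ^ y = [~ x, y].
Proof.
move=> y2 z2; have yV : y^-1 = y by apply/eqP; rewrite eq_invg_mul -expg2 y2.
have zV : [~ x, y]^-1 = [~ x, y] by apply/eqP; rewrite eq_invg_mul -expg2 z2.
split; first by rewrite /commg /conjg yV !mulgA -[RHS]mulgA -expg2 y2 mulg1.
rewrite -[RHS]zV /commg /conjg !invMg !invgK yV !mulgA.
by rewrite -[LHS]mulgA -expg2 y2 mulg1.
Qed.

(** The elements [w], [z], [y] commute and have trivial square, so they generate a group [N] of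
    order at most 8. It is normalised by [x], as [y ^ x = z * y], [z ^ x = z * w] and [w ^ x = w],
    and [x] contributes at most a factor 4. *)
Lemma G1_rel_card (gT : finGroupType) (x y : gT) :
  G1_rel x y -> #|<[x]> <*> <[y]>| <= 32.
Proof.
case=> x4 y2; set z := [~ x, y]; set w := [~ z, x] => z2 w2 [wx wy].
have [yx zy] := commg_invol y2 z2; rewrite -/z in yx zy.
have zx : z ^ x = z * w by rewrite /w commgEl mulKVg.
have wz : commute w z.
  by apply: commuteM; [apply: commuteV | apply: commuteM; first apply: commuteV;
     last apply: commuteM].
have wxE : w ^ x = w by apply/conjg_fixP/commgP.
have cwz : <[z]> \subset 'C(<[w]>).
  by rewrite cent_cycle cycle_subG cent1C; apply/cent1P.
pose H := (<[w]> <*> <[z]>)%G; pose N := (H <*> <[y]>)%G.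
have cHy : <[y]> \subset 'C(H).
  rewrite cycle_subG /= /H cent_gen centU inE !cent_cycle.
  have czy : commute z y by apply/commgP/conjg_fixP.
  by rewrite !(cent1C y); apply/andP; split; apply/cent1P.
have Nw : w \in N by rewrite !mem_gen // !inE mem_gen // !inE cycle_id.
have Nz : z \in N by rewrite !mem_gen // !inE mem_gen // !inE cycle_id orbT.
have Ny : y \in N by rewrite mem_gen // !inE cycle_id orbT.
have nNx : <[x]> \subset 'N(N).
  rewrite cycle_subG inE -genJ gen_subG conjUg subUset -genJ gen_subG conjUg.
  rewrite subUset -!cycleJ !cycle_subG yx zx.
  by rewrite wxE -andbA; apply/and3P; split=> //; apply: groupM.
have sub : <[x]> <*> <[y]> \subset N * <[x]>.
  rewrite -(norm_joinEr nNx) join_subG joing_subr cycle_subG.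
  by rewrite mem_gen // inE Ny.
apply: leq_trans (subset_leq_card sub) _.
apply: leq_trans (leq_card_mulg N <[x]>) _.
rewrite (_ : 32 = 8 * 4)%N // leq_mul ?order_leq //=.
rewrite /N /= cent_joinEr //; apply: leq_trans (leq_card_mulg H <[y]>) _.
rewrite (_ : 8 = 4 * 2)%N // leq_mul ?order_leq //=.
rewrite /H /= cent_joinEr //; apply: leq_trans (leq_card_mulg <[w]> <[z]>) _.
by rewrite (_ : 4 = 2 * 2)%N // leq_mul ?order_leq.
Qed.

Lemma G1_homgP (gT : finGroupType) (G : {group gT}) :
  reflect (exists x y, G1_rel x y /\ <[x]> <*> <[y]> = G)
    (G \homg Grp (x : y : (x ^+ 4, y ^+ 2, [~ x, y] ^+ 2, [~ x, y, x] ^+ 2,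
                        [~ x, y, x] * x = x * [~ x, y, x],
                        [~ x, y, x] * y = y * [~ x, y, x]))).
Proof.
apply: (iffP existsP) => [[[x y] /= /eqP[? ? ? ? ? ? ?]] |].
  by exists x, y.
case=> x [y [[? ? ? ? [c1 c2]] ?]]; exists (x, y) => /=.
by rewrite !xpair_eqE; do ?[apply/andP; split]; apply/eqP.
Qed.

(* In the product with any other group satisfying the relations, the pairs of
   generators span a group of order at most 32, i.e. the graph of a morphism. *)
Lemma G1_rel_isog (gT : finGroupType) (x y : gT) :
  G1_rel x y -> 32 <= #|<[x]> <*> <[y]>| -> isog_G1 [group of <[x]> <*> <[y]>].
Proof.
move=> rxy le32; apply: intro_isoGrp; first by apply/G1_homgP; exists x, y.
move=> rT H /G1_homgP[u [v [ruv <-]]].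
pose X := (x, u); pose Y := (y, v); pose P := <[X]> <*> <[Y]>.
have rXY : G1_rel X Y.
  case: rxy ruv => [? ? ? ? [c1 c2]] [? ? ? ? [d1 d2]].
  by do ?split; apply/eqP; rewrite xpair_eqE; apply/andP; split; apply/eqP.
have im1 : fst @* P = <[x]> <*> <[y]>.
  by rewrite morphimY ?subsetT // !morphim_cycle ?inE.
have im2 : snd @* P = <[u]> <*> <[v]>.
  by rewrite morphimY ?subsetT // !morphim_cycle ?inE.
have hom1 : <[x]> <*> <[y]> \homg P by rewrite -im1 morphim_homg ?subsetT.
have hom2 : <[u]> <*> <[v]> \homg P by rewrite -im2 morphim_homg ?subsetT.
have iso : <[x]> <*> <[y]> \isog P.
  by rewrite isogEcard hom1 (leq_trans _ le32) ?G1_rel_card.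
by apply: homg_trans hom2 _; rewrite isog_hom // isog_sym.
Qed.

Definition D8_gens (r s : 'D_8) : Prop :=
  [/\ <[r]> <*> <[s]> = [set: 'D_8], r ^+ 4 = 1, s ^+ 2 = 1 & r ^ s = r^-1] /\
  [/\ r ^+ 2 != 1, s != 1 & r ^+ 2 != s].

Lemma D8_gens_exist : exists r s, D8_gens r s.
Proof.
have := isoGrp_hom (@Grp_dihedral 4 isT).
case/existsP=> -[r s] /= /eqP[gen r4 s2 rs].
have cD : #|[set: 'D_8]| = 8 by exact: (@card_dihedral 4).
have sV : s^-1 = s by apply/eqP; rewrite eq_invg_mul -expg2 s2.
have nrs : <[s]> \subset 'N(<[r]>).
  by rewrite cycle_subG inE -cycleJ rs cycle_subG groupV cycle_id.
(* If one of the three inequalities failed, [r] and [s] would generate a group of order at most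
   4. *)
have le8 a b : (#[r] <= a)%N -> (#[s] <= b)%N -> (8 <= a * b)%N.
  move=> ra sb; rewrite -cD -gen norm_joinEr //.
  exact: leq_trans (leq_card_mulg <[r]> <[s]>) (leq_mul ra sb).
have r2 : r ^+ 2 != 1.
  by apply/eqP=> e; have := le8 2 2 (order_leq e) (order_leq s2).
have s1 : s != 1.
  by apply/eqP=> e; have := le8 4 1%N (order_leq r4) (@order_leq _ s 0%N e).
have r2s : r ^+ 2 != s.
  apply/eqP=> e; have : (#|[set: 'D_8]| <= #|<[r]>|)%N.
    by rewrite subset_leq_card // -gen join_subG subxx cycle_subG -e mem_cycle.
  by rewrite cD => le8r; have := leq_trans le8r (order_leq r4).
by exists r, s.
Qed.

Lemma D8_gens_normal r s : D8_gens r s -> <[s]> \subset 'N(<[r]>).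
Proof.
case=> [[_ _ _ rs] _].
by rewrite cycle_subG inE -cycleJ rs cycle_subG groupV cycle_id.
Qed.

Lemma D8_gens_notin r s : D8_gens r s -> r ^+ 2 \notin <[s]>.
Proof.
case=> [[_ _ s2 _] [r2 s1 r2s]]; have os : #[s] = 2.
  by apply: nt_prime_order.
by rewrite cycle2g // !inE negb_or r2 r2s.
Qed.

(** The Klein group [V] generated by [r ^+ 2] and [s] has index 2; the morphism is the indicator of
    its complement. *)
Lemma D8_to_Z2_exists :
  exists lam : {morphism [set: 'D_8] >-> 'Z_2}, 'ker lam \isog [set: 'Z_2 * 'Z_2].
Proof.
have [r [s gens]] := D8_gens_exist; have nrs := D8_gens_normal gens.
have r2s' := D8_gens_notin gens; case: gens => [[gen r4 s2 rs] [r2 s1 _]].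
have or2 : #[r ^+ 2] = 2 by apply: nt_prime_order; rewrite // -expgM.
have os : #[s] = 2 by apply: nt_prime_order.
have c2s : commute (r ^+ 2) s.
  apply/commgP/conjg_fixP; rewrite conjXg rs expVgn; apply/eqP.
  by rewrite eq_invg_mul -expgD r4.
have cents : <[s]> \subset 'C(<[r ^+ 2]>).
  by rewrite cent_cycle cycle_subG cent1C; apply/cent1P.
pose V := (<[r ^+ 2]> <*> <[s]>)%G.
have oV : #|V| = 4.
  rewrite /V /= cent_joinEr // TI_cardMg; first by rewrite -!orderE or2 os.
  by rewrite prime_TIg // -?orderE ?or2 // cycle_subG.
have abV : 2.-abelem V.
  rewrite abelemE //; apply/andP; split.
    by rewrite abelianY !cycle_abelian.
  apply/exponentP=> u; rewrite /V /= cent_joinEr //.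
  case/mulsgP=> _ _ /cycleP[i ->] /cycleP[j ->] ->.
  rewrite expgMn; last by apply: commuteX; apply/commute_sym/commuteX/commute_sym.
  by rewrite (expgAC _ i) (expgAC _ j) -(expgM r) r4 s2 !expg1n mulg1.
have iV : #|[set: 'D_8] : V| = 2.
  by rewrite -divgS ?subsetT // oV (@card_dihedral 4).
pose lam (u : 'D_8) : 'Z_2 := inZp (u \notin V).
have lamM : {in [set: 'D_8] &, {morph lam : u v / u * v}}.
  move=> u v _ _; rewrite /lam; have [Vu|nVu] := boolP (u \in V).
    by rewrite groupMl //; apply/eqP; case: (v \in V).
  have [Vv|nVv] := boolP (v \in V); first by rewrite groupMr // nVu; apply/eqP.
  have : u \in V :* v^-1.
    by rewrite (rcoset_index2 (subsetT _) iV) ?inE ?groupV ?nVv ?nVu.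
  by rewrite mem_rcoset invgK => ->; apply/eqP.
exists (Morphism lamM).
have -> : 'ker (Morphism lamM) = V.
  apply/setP=> u; apply/kerP/idP; rewrite ?inE //= /lam.
    by case: (u \in V) => // /eqP.
  by move=> ->; apply/eqP.
rewrite (isog_abelem_card _ abV) oV cardsT card_prod !card_ord eqxx andbT.
rewrite abelemE //; apply/andP; split.
  by apply/centsP=> -[u1 u2] _ [v1 v2] _; congr (_, _); apply: (@addrC 'Z_2).
by apply/exponentP=> -[[[|[|//]] ?] [[|[|//]] ?]] _; apply/eqP.
Qed.

Section Pullback.
Variable lam : {morphism [set: 'D_8] >-> 'Z_2}.
Hypothesis kerV4 : 'ker lam \isog [set: 'Z_2 * 'Z_2].

(** The kernel has exponent 2, so it misses the rotation [r], whose square is nontrivial. If it also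
    misses the reflection [s], it contains the reflection [r * s], which replaces [s]. *)
Lemma D8_gens_adapted : exists r s, [/\ D8_gens r s, lam r != 1 & lam s = 1].
Proof.
have [r [s gens]] := D8_gens_exist.
have := gens; case=> [[gen r4 s2 rs] [r2 s1 r2s]].
have sV : s^-1 = s by apply/eqP; rewrite eq_invg_mul -expg2 s2.
have lr : lam r != 1.
  apply/eqP=> lr1; case/isogP: kerV4 => f injf _.
  have kr : r \in 'ker lam by apply/kerP; rewrite ?inE.
  case/eqP: r2; apply: (injmP injf); rewrite ?groupX ?group1 //.
  rewrite morphX // morph1; case: (f r) => -[[|[|//]] ?] [[|[|//]] ?];
    exact/eqP.
have [ls|ls] := eqVneq (lam s) 1; first by exists r, s.
exists r, (r * s); split=> //; [split; split=> // | ].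
- apply/eqP; rewrite -subTset -gen join_subG joing_subl cycle_subG /=.
  have Gr : r \in <[r]> <*> <[r * s]> by rewrite mem_gen // inE cycle_id.
  by rewrite -(groupMl _ Gr) mem_gen // inE cycle_id orbT.
- by rewrite expg2 -mulgA (mulgA s) -{1}sV -[_ * _ * s]mulgA -/(r ^ s) rs mulgV.
- by rewrite conjgM (conjgE r r) mulKg.
- apply: contraNneq r2 => e; have es : s = r^-1 by apply: (mulgI r); rewrite e mulgV.
  by rewrite expg2 -eq_invg_mul -rs es conjgE invgK mulgV mulg1.
- apply: contraNneq r2 => e; have -> : r = s by apply: (mulgI r); rewrite -e expg2.
  by rewrite s2.
- rewrite morphM ?inE //; move: (lam r) (lam s) lr ls.
  by case=> -[|[|//]] ? [[|[|//]] ?] // _ _; apply/eqP.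
Qed.

Lemma eta4M : {morph eta4 : u v / u * v}.
Proof.
by case=> -[|[|[|[|//]]]] ? [[|[|[|[|//]]]] ?]; apply/eqP.
Qed.

(** The generators are [X = (r, g)], with [g] a generator of ['Z_4], and [Y = (s, 1)]. The two
    non-memberships later provide field elements fixed by a subgroup but moved by [X ^+ 2]. *)
Lemma DC_pullback_generators : exists X Y : 'D_8 * 'Z_4,
  [/\ <[X]> <*> <[Y]> = DC_pullback lam, X ^+ 4 = 1, Y ^+ 2 = 1,
      [~ X, Y] ^+ 2 = 1 & [~ X, Y, X] = 1] /\
  X ^+ 2 \notin <<[set Y; [~ X, Y]]>> /\
  X ^+ 2 \notin <<[set Y; X ^+ 2 * [~ X, Y]]>>.
Proof.
have [r [s [gens lr ls]]] := D8_gens_adapted.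
have nrs := D8_gens_normal gens; have r2s' := D8_gens_notin gens.
case: gens => [[gen r4 s2 rs] [r2 s1 r2s]].
pose g : 'Z_4 := Zp1; pose X := (r, g); pose Y : 'D_8 * 'Z_4 := (s, 1).
have lrg : lam r = eta4 g.
  by case: (lam r) lr => -[|[|//]] ? // _; apply/eqP.
have r2V : r ^- 2 = r ^+ 2 by apply/eqP; rewrite eq_invg_mul -expgD r4.
have Z : [~ X, Y] = (r ^+ 2, 1).
  congr (_, _); last by apply/eqP.
  by change ([~ r, s] = r ^+ 2); rewrite commgEl rs -invMg.
have X2 : X ^+ 2 = (r ^+ 2, g ^+ 2) by [].
have pairE (p q : 'D_8 * 'Z_4) : p.1 = q.1 -> p.2 = q.2 -> p = q.
  by case: p q => ? ? [? ?] /= -> ->.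
exists X, Y; rewrite Z X2; split; last split.
- split.
  + apply/eqP; rewrite eqEsubset; apply/andP; split.
      have gDC : group_set (DC_pullback lam).
        apply/group_setP; split=> [|[u v] [u' v']]; first by rewrite inE morph1.
        by rewrite !inE /= => /eqP e /eqP e'; rewrite morphM ?inE // e e' -eta4M.
      rewrite (_ : DC_pullback lam = Group gDC) // join_subG !cycle_subG.
      by rewrite !inE /= ls lrg eqxx.
    (* With [u = r^i s^j], the pair [(u, v)] differs from [X^i Y^j] by some [(1, t)] with [t] in the
       kernel of [eta4], that is [t = 1] or [t = g^2]; and [(1, g^2)] is [X^2 [X, Y]]. *)
    apply/subsetP=> -[u v]; rewrite inE /= => /eqP luv.
    have : u \in <[r]> * <[s]> by rewrite -norm_joinEr // gen inE.
    case/mulsgP=> _ _ /cycleP[i ->] /cycleP[j ->] Du.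
    have DX : X ^+ i = (r ^+ i, g ^+ i) by elim: (i) => // k IH; rewrite !expgS IH.
    have DY : Y ^+ j = (s ^+ j, 1).
      by elim: (j) => // k IH; rewrite !expgS IH; apply: pairE => //; apply/eqP.
    have etaX : eta4 (g ^+ i) = lam r ^+ i.
      by elim: (i) => [|k IH]; [apply/eqP | rewrite !expgS eta4M IH lrg].
    have PX : X \in <[X]> <*> <[Y]> by rewrite mem_gen // inE cycle_id.
    have PY : Y \in <[X]> <*> <[Y]> by rewrite mem_gen // inE cycle_id orbT.
    pose t := g ^- i * v.
    have Duv : (u, v) = X ^+ i * Y ^+ j * (1, t).
      by rewrite DX DY; apply: pairE; rewrite /= ?mulg1 // mulKVg.
    have et : eta4 t = 1.
      apply: (mulgI (eta4 (g ^+ i))); rewrite -eta4M mulKVg -luv Du.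
      by rewrite morphM ?inE // !morphX ?inE // ls expg1n !mulg1 etaX.
    have Pt : (1, t) \in <[X]> <*> <[Y]>.
      have [->|->] : t = 1 \/ t = g ^+ 2; first 1 last.
      - exact: group1.
      - have -> : (1, g ^+ 2) = X ^+ 2 * [~ X, Y].
          by rewrite Z X2; apply: pairE => /=; rewrite ?mulg1 // -(expgD r 2 2) r4.
        by rewrite groupM ?groupX ?groupR.
      by case: (t) et => -[|[|[|[|//]]]] ? // _; [left|right]; apply/eqP.
    by rewrite Duv !groupM ?groupX.
  + by apply: pairE => //; apply/eqP.
  + by apply: pairE => //; apply/eqP.
  + by apply: pairE; [change (r ^+ 2 ^+ 2 = 1); rewrite -expgM | apply/eqP].
  + apply: pairE; last (by apply/eqP); change ([~ r ^+ 2, r] = 1).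
    by apply/eqP/commgP; apply/commute_sym/commuteX.
(* [Y] and [[~ X, Y]] have trivial second coordinate, unlike [X ^+ 2]. *)
- apply/negP=> K; have /subsetP/(_ _ K) : <<[set Y; (r ^+ 2, 1)]>>
      \subset setX_group [set: 'D_8]%G 1%G.
    by rewrite gen_subG subUset !sub1set !inE /= !eqxx.
  by rewrite !inE.
(* Since [X ^+ 2 * [~ X, Y]] is [(1, g ^+ 2)], first coordinates stay in [<[s]>], which misses
   [r ^+ 2]. *)
- apply/negP=> K; have /subsetP/(_ _ K) : <<[set Y; (r ^+ 2, g ^+ 2) * (r ^+ 2, 1)]>>
      \subset setX_group <[s]>%G [set: 'Z_4]%G.
    rewrite gen_subG subUset !sub1set !inE /= cycle_id !andbT /=.
    by rewrite -(expgD r 2 2) r4 group1.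
  by rewrite !inE /= andbT; apply/negP.
Qed.
End Pullback.
End GroupG1.

(** * Quadratic extensions *)

Lemma pchar2_neq0 (F : fieldType) : 2%N \notin [pchar F] -> 2%:R != 0 :> F.
Proof. by apply: contra => e; rewrite inE. Qed.

Section QuadraticExtensions.
Variables (F : fieldType) (L : fieldExtType F).
Implicit Types (K : {subfield L}) (x y v : L).

Lemma adjoin_degree_sqrt K x : x ^+ 2 \in K -> (adjoin_degree K x <= 2)%N.
Proof.
move=> Kx2; rewrite -ltnS -size_minPoly -(size_XnsubC (x ^+ 2) (isT : (0 < 2)%N)).
apply: dvdp_leq; first by rewrite -size_poly_gt0 size_XnsubC.
apply: minPoly_dvdp; first by rewrite rpredB ?rpredX ?polyOverX ?polyOverC.
by rewrite rootE !hornerE subrr.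
Qed.

Lemma dim_adjoin_sqrt K x : x ^+ 2 \in K -> x \notin K ->
  \dim <<K; x>> = (2 * \dim K)%N.
Proof.
move=> Kx2 nKx; rewrite dim_Fadjoin; congr (_ * _)%N; apply/eqP.
rewrite eqn_leq adjoin_degree_sqrt //= ltn_neqAle lt0n eq_sym adjoin_deg_eq1 nKx.
by rewrite /adjoin_degree.
Qed.

Lemma mem_adjoin_sqrt K x v : x ^+ 2 \in K -> v \in <<K; x>>%VS ->
  exists s t, [/\ s \in K, t \in K & v = s + t * x].
Proof.
move=> Kx2 Kv; set p := Fadjoin_poly K x v.
have Kp : p \is a polyOver K by apply: Fadjoin_polyOver.
exists p`_0, p`_1; split; try exact: (polyOverP Kp).
rewrite -(Fadjoin_poly_eq Kv) -/p.
have szp : (size p <= 2)%N.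
  exact: leq_trans (size_Fadjoin_poly _ _ _) (adjoin_degree_sqrt Kx2).
by rewrite (horner_coef_wide _ szp) !big_ord_recl big_ord0 expr0 mulr1 addr0.
Qed.

Hypothesis char2 : 2%N \notin [pchar F].

Lemma two_neq0 : 2%:R != 0 :> L.
Proof.
by rewrite -scaler_nat scaler_eq0 oner_eq0 orbF pchar2_neq0.
Qed.

Lemma eq_opp0 v : v = - v -> v = 0.
Proof.
move/eqP; rewrite -addr_eq0 -mulr2n -mulr_natl mulf_eq0 (negPf two_neq0).
by move/eqP.
Qed.

Lemma separable_adjoin_sqrt K x : x ^+ 2 \in K -> separable_element K x.
Proof.
move=> Kx2; have [->|x0] := eqVneq x 0; first by rewrite base_separable ?mem0v.
apply/separable_elementP; exists ('X^2 - (x ^+ 2)%:P); split.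
- by rewrite rpredB ?rpredX ?polyOverX ?polyOverC.
- by rewrite rootE !hornerE subrr.
have -> : 'X^2 - (x ^+ 2)%:P = \prod_(r <- [:: x; - x]) ('X - r%:P).
  by rewrite !big_cons big_nil rmorphXn rmorphN /=; ring.
rewrite separable_prod_XsubC /= inE andbT.
by apply: contra x0 => /eqP/eq_opp0->.
Qed.

Lemma in_algI (c d : F) : c%:A = d%:A :> L -> c = d.
Proof. exact: (fmorph_inj (in_alg L)). Qed.

Lemma sqrt_in_base x a : x ^+ 2 = a%:A -> (x \in 1%VS) -> is_sq a.
Proof.
move=> xa /vlineP[t Dx]; exists t; apply: in_algI.
by rewrite -xa Dx exprZn expr1n.
Qed.
End QuadraticExtensions.

(** * Degree four as a condition on square classes *)

Section Biquadratic.
Variables (F : fieldType) (char2 : 2%N \notin [pchar F]).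
Implicit Types a b : F.

Lemma sqrt_notin (L : fieldExtType F) (x : L) a :
  x ^+ 2 = a%:A -> ~ is_sq a -> x \notin 1%VS.
Proof. by move=> xa nsa; apply/negP=> /(sqrt_in_base xa). Qed.

(** If [y = s + t x], then [2 s t x = b - s^2 - a t^2]. For [t = 0] this makes [b] a square, for
    [s = 0] it makes [a b = (a t)^2], and otherwise it puts [x] in [F]. *)
Lemma sqrt_notin_adjoin (L : fieldExtType F) (x y : L) a b :
    x ^+ 2 = a%:A -> y ^+ 2 = b%:A -> ~ is_sq a -> ~ is_sq b -> ~ is_sq (a * b) ->
  y \notin <<1; x>>%VS.
Proof.
move=> xa yb nsa nsb nsab; apply/negP=> Ky.
have x1 := sqrt_notin xa nsa.
have x21 : x ^+ 2 \in 1%AS by rewrite xa rpredZ ?mem1v.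
have [_ [_ [/vlineP[s ->] /vlineP[t ->] Dy]]] := mem_adjoin_sqrt x21 Ky.
have [t0|t0] := eqVneq t 0.
  apply: nsb; apply: (sqrt_in_base yb).
  by rewrite Dy t0 scale0r mul0r addr0 rpredZ ?mem1v.
have [s0|s0] := eqVneq s 0.
  apply: nsab; exists (a * t); apply: (@in_algI _ L).
  rewrite -[in RHS]in_algE -[in LHS]in_algE !(rmorphM, rmorphXn) /= -yb Dy s0.
  by rewrite scale0r add0r -xa; ring.
case/negP: x1; have e : x * (2 * s * t)%:A = (b - s ^+ 2 - a * t ^+ 2)%:A.
  rewrite -!in_algE !(rmorphB, rmorphM, rmorphXn, rmorph_nat) /= -yb -xa Dy.
  by rewrite -?in_algE; ring.
have nz : (2 * s * t)%:A != 0 :> L.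
  by rewrite scaler_eq0 oner_eq0 orbF mulf_neq0 // mulf_neq0 // pchar2_neq0.
have -> : x = ((b - s ^+ 2 - a * t ^+ 2) / (2 * s * t))%:A.
  by apply: (mulIf nz); rewrite e -!in_algE fmorph_div /= divfK.
by rewrite rpredZ ?mem1v.
Qed.

Lemma dim_biquadratic (L : fieldExtType F) (x y : L) a b :
    x ^+ 2 = a%:A -> y ^+ 2 = b%:A -> x \notin 1%VS -> y \notin <<1; x>>%VS ->
  \dim <<1 & [:: x; y]>> = 4%N.
Proof.
move=> xa yb x1 y1; rewrite adjoin_cons adjoin_seq1.
have A1 c : c%:A \in (1%AS : {subfield L}) by rewrite rpredZ ?mem1v.
rewrite (@dim_adjoin_sqrt _ _ <<1; x>>%AS) //.
  by rewrite (@dim_adjoin_sqrt _ _ 1%AS) ?dimv1 // xa.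
by rewrite yb (subvP (sub1v _)).
Qed.

(** Each of the two adjunctions at most doubles the degree, so degree 4 forces both to be proper,
    and a square among [a], [b], [a b] makes one of them trivial. Conversely both square roots live
    in a splitting field of [(X^2 - a)(X^2 - b)]. *)
Lemma biquadratic_deg4P a b :
  biquadratic_deg4 a b <-> [/\ ~ is_sq a, ~ is_sq b & ~ is_sq (a * b)].
Proof.
split=> [[L [x [y [xa [yb dim4]]]]] | [nsa nsb nsab]].
  have A1 c : c%:A \in (1%AS : {subfield L}) by rewrite rpredZ ?mem1v.
  have le2 (K : {subfield L}) v c : v ^+ 2 = c%:A ->
      (\dim <<K; v>> <= 2 * \dim K)%N.
    move=> vc; rewrite dim_Fadjoin leq_mul2r adjoin_degree_sqrt ?orbT //.
    by rewrite vc (subvP (sub1v _)).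
  have sq_mem (K : {subfield L}) v t : v ^+ 2 = t ^+ 2 -> t \in K -> v \in K.
    by move/eqP; rewrite eqf_sqr => /orP[]/eqP->; rewrite ?rpredN.
  have le2x := le2 1%AS x a xa; have le2y := le2 1%AS y b yb.
  move: dim4; rewrite adjoin_cons adjoin_seq1 dimv1 muln1 in le2x le2y * => dim4.
  split=> -[t Dt].
  - have /Fadjoin_idP e : x \in (1%AS : {subfield L}).
      by apply: (sq_mem _ _ t%:A) => //; rewrite xa Dt exprZn expr1n.
    by move: dim4 le2y; rewrite e => ->.
  - have /Fadjoin_idP e : y \in <<1; x>>%AS.
      apply: (sq_mem _ _ t%:A); first by rewrite yb Dt exprZn expr1n.
      by rewrite (subvP (sub1v _)).
    by move: dim4 le2x; rewrite e => ->.
  - have [a0|a0] := eqVneq a 0.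
      have x0 : x = 0 by apply/eqP; rewrite -sqrf_eq0 xa a0 scale0r.
      by move: dim4 le2y; rewrite x0 Fadjoin0 => ->.
    have /Fadjoin_idP e : y \in <<1; x>>%AS.
      apply: (sq_mem _ _ ((t / a)%:A * x)).
        rewrite exprMn exprZn expr1n xa yb -scalerAl mul1r scalerA; congr (_ *: _).
        by rewrite expr_div_n -Dt; field.
      by rewrite rpredM ?memv_adjoin // (subvP (sub1v _)).
    by move: dim4 le2x; rewrite e => ->.
have p0 : ('X^2 - a%:P) * ('X^2 - b%:P) != 0 :> {poly F}.
  by rewrite mulf_neq0 // -size_poly_gt0 size_XnsubC.
have [L [rs Dp _]] := splitting_field_exists p0.
have ext c : ('X^2 - c%:P) %| ('X^2 - a%:P) * ('X^2 - b%:P) ->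
    exists x : L, x ^+ 2 = c%:A.
  rewrite -(dvdp_map (in_alg L)) (eqp_dvdr _ Dp) => /dvdp_prod_XsubC[m Dm].
  have := eqp_size Dm; rewrite size_map_poly size_XnsubC // size_prod_XsubC.
  case: mask Dm => // x s Dm _; exists x.
  have : root (\prod_(r <- x :: s) ('X - r%:P)) x.
    by rewrite root_prod_XsubC mem_head.
  rewrite -(eqp_root Dm) rootE rmorphB /= map_polyXn map_polyC /= !hornerE.
  by rewrite subr_eq0 => /eqP.
have [x xa] := ext a (dvdp_mulr _ (dvdpp _)).
have [y yb] := ext b (dvdp_mull _ (dvdpp _)).
exists L, x, y; split=> //; split=> //; apply: (dim_biquadratic xa yb).
  exact: sqrt_notin xa nsa.
exact: sqrt_notin_adjoin xa yb nsa nsb nsab.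
Qed.
End Biquadratic.

(** * Norm equations from a pullback extension *)

Section GaloisAction.
Variables (F : fieldType) (L : splittingFieldType F).
Implicit Types (g h : gal_of {:L}) (u : L).

Lemma galfM g h u : (g * h)%g u = h (g u).
Proof. by rewrite galM ?memvf. Qed.

Lemma gal_alg g (c : F) : g c%:A = c%:A.
Proof. by rewrite linearZ /= rmorph1. Qed.

Lemma gal_in1 g : g \in ('Gal({:L} / 1))%g.
Proof. by rewrite gal_kHom ?sub1v ?k1AHom. Qed.

Lemma gal_gen_fix (A : {set gal_of {:L}}) u :
  (forall g, g \in A -> g u = u) -> forall g, g \in <<A>>%g -> g u = u.
Proof.
move=> Au g; rewrite -gal_generated => Ag.
by apply: (fixed_gal (subvf _) Ag); apply/fixedFieldP; rewrite ?memvf.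
Qed.

(** If [h] fixed all that [A] fixes, it would lie in the Galois group over the fixed field of [A],
    which is [<<A>>]. *)
Lemma gal_gen_moved (A : {set gal_of {:L}}) h : h \notin <<A>>%g ->
  exists u, (forall g, g \in A -> g u = u) /\ h u != u.
Proof.
rewrite -gal_generated gal_kHom ?subvf // => nh; apply: NNPP => nex.
case/negP: nh; apply/kAHomP=> u /mem_fixedFieldP[_ Au]; apply/eqP.
by apply/idPn=> hu; apply: nex; exists u.
Qed.

Lemma gal_fixed_base (x y : gal_of {:L}) u : galois 1 {:L} ->
    (<[x]> <*> <[y]> = 'Gal({:L} / 1))%g -> x u = u -> y u = u ->
  exists c : F, u = c%:A.
Proof.
move=> /galois_fixedField galL gen xu yu.
suff : u \in fixedField ('Gal({:L} / 1))%g by rewrite galL => /vlineP[c ->]; exists c.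
apply/fixedFieldP; rewrite ?memvf // => g; rewrite -gen.
have -> : (<[x]> <*> <[y]> = <<[set x; y]>>)%g.
  by rewrite joing_idl joing_idr.
by apply: gal_gen_fix => h; rewrite !inE => /orP[]/eqP->.
Qed.
End GaloisAction.

Section NormEquations.
Variables (F : fieldType) (char2 : 2%N \notin [pchar F]).
Variables (L : splittingFieldType F) (x y : gal_of {:L}).
Hypotheses (galL : galois 1 {:L}) (gen : (<[x]> <*> <[y]> = 'Gal({:L} / 1))%g).
Hypothesis x4 : (x ^+ 4 = 1)%g.
Local Notation z := [~ x, y]%g.
Hypotheses (z2 : (z ^+ 2 = 1)%g) (zx : [~ z, x]%g = 1%g).

Let nz2 : (2%:R : L) != 0. Proof. exact: two_neq0. Qed.

Let x4E u : x (x (x (x u))) = u.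
Proof.
have := congr1 (fun g : gal_of {:L} => g u) x4.
by rewrite /= !expgS expg0 mulg1 !galfM gal_id.
Qed.

Let zxE u : z (x u) = x (z u).
Proof. by rewrite -!galfM; congr ((_ : gal_of {:L}) _); apply/esym/commgP/eqP. Qed.

Let xyE u : y (x u) = z (x (y u)).
Proof. by rewrite -!galfM mulgA -commgC. Qed.

Let zzE u : z (z u) = u.
Proof. by rewrite -galfM -expg2 z2 gal_id. Qed.

Let y_x2E u : y (x (x u)) = x (x (y u)).
Proof. by rewrite xyE xyE -zxE zzE. Qed.

(* [B ^+ 2] is fixed by [x ^+ 2] and [y], hence lies in [F + F * al], and its norm
   down to [F] is [(B * x B) ^+ 2]. *)
Lemma eigenvector_norm (al B : L) (a e : F) :
    al ^+ 2 = a%:A -> al != 0 -> x al = - al -> y al = al ->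
    y B = B -> x (x B) = - B -> z B = e%:A * B -> e ^+ 2 = 1 ->
  exists p q : F, (B * x B) ^+ 2 = (p ^+ 2 - a * q ^+ 2)%:A.
Proof.
move=> ala al0 xal yal yB xxB zB e2.
have yxB : y (x B) = e%:A * x B by rewrite xyE yB zxE zB rmorphM /= gal_alg.
have e2L : (e%:A : L) ^+ 2 = 1 by rewrite exprZn expr1n e2 scale1r.
pose P := (B ^+ 2 + x B ^+ 2) / 2; pose Q := (B ^+ 2 - x B ^+ 2) / (2 * al).
have [p Dp] : exists p : F, P = p%:A.
  apply: (gal_fixed_base galL gen); rewrite /P.
    by rewrite fmorph_div rmorphD !rmorphXn rmorph_nat /= xxB sqrrN addrC.
  by rewrite fmorph_div rmorphD !rmorphXn rmorph_nat /= yB yxB exprMn e2L mul1r.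
have [q Dq] : exists q : F, Q = q%:A.
  apply: (gal_fixed_base galL gen); rewrite /Q.
    rewrite fmorph_div rmorphB !rmorphXn rmorphM rmorph_nat /= xxB sqrrN xal.
    by field; rewrite oppr_eq0 al0 nz2.
  rewrite fmorph_div rmorphB !rmorphXn rmorphM rmorph_nat /= yB yxB exprMn e2L.
  by rewrite mul1r yal.
exists p, q; rewrite -in_algE rmorphB rmorphXn rmorphM rmorphXn /= -Dp -Dq -ala /P /Q.
by field; rewrite al0 nz2.
Qed.

Hypotheses (nx1 : (x ^+ 2)%g \notin <<[set y; z]>>%g)
           (nx2 : (x ^+ 2)%g \notin <<[set y; (x ^+ 2 * z)%g]>>%g).

(** The non-memberships yield -1-eigenvectors [B1], [B2] of [x ^+ 2] fixed by [y], with [z B1 = B1]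
    and [z B2 = - B2]. Then [x] negates [al = B1 * x B1] and [u2 = B2 * x B2], while [y] fixes [al]
    and negates [u2]. So [al] and [u2] are square roots of [a] and [a b], and [eigenvector_norm]
    makes [a] and [a b] norms from [F(al)]. *)
Lemma norm_equations : exists a b : F,
  biquadratic_deg4 a b /\ quat_split a a /\ quat_split a b.
Proof.
have [e1 [fix1 mv1]] := gal_gen_moved nx1.
have [e2 [fix2 mv2]] := gal_gen_moved nx2.
have ye1 : y e1 = e1 by apply: fix1; rewrite !inE eqxx.
have ze1 : z e1 = e1 by apply: fix1; rewrite !inE eqxx orbT.
have ye2 : y e2 = e2 by apply: fix2; rewrite !inE eqxx.
have ze2 : z (x (x e2)) = e2.
  have := fix2 (x ^+ 2 * z)%g; rewrite !galfM; apply.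
  by rewrite !inE eqxx orbT.
rewrite expg2 !galfM in mv1 mv2.
pose B1 := e1 - x (x e1); pose B2 := e2 - x (x e2).
have B10 : B1 != 0 by rewrite subr_eq0 eq_sym.
have B20 : B2 != 0 by rewrite subr_eq0 eq_sym.
have yB1 : y B1 = B1 by rewrite rmorphB /= y_x2E ye1.
have yB2 : y B2 = B2 by rewrite rmorphB /= y_x2E ye2.
have xB1 : x (x B1) = - B1 by rewrite !rmorphB /= x4E opprB.
have xB2 : x (x B2) = - B2 by rewrite !rmorphB /= x4E opprB.
have zB1 : z B1 = 1%:A * B1 by rewrite rmorphB /= !zxE ze1 scale1r mul1r.
have zB2 : z B2 = (-1)%:A * B2.
  rewrite rmorphB /= ze2 scaleN1r mulN1r opprB; congr (_ - _).
  by rewrite -[in RHS]ze2 zxE zxE x4E.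
pose al := B1 * x B1; pose u2 := B2 * x B2.
have inj0 (g : gal_of {:L}) u : u != 0 -> g u != 0 by rewrite fmorph_eq0.
have al0 : al != 0 by rewrite mulf_neq0 ?inj0.
have u20 : u2 != 0 by rewrite mulf_neq0 ?inj0.
have xal : x al = - al by rewrite rmorphM /= xB1 mulrN mulrC.
have xu2 : x u2 = - u2 by rewrite rmorphM /= xB2 mulrN mulrC.
have yal : y al = al.
  by rewrite rmorphM /= yB1 xyE yB1 zxE zB1 scale1r mul1r.
have yu2 : y u2 = - u2.
  by rewrite rmorphM /= yB2 xyE yB2 zxE zB2 scaleN1r mulN1r rmorphN mulrN.
have [a Da] : exists a : F, al ^+ 2 = a%:A.
  by apply: (gal_fixed_base galL gen); rewrite rmorphXn /= ?xal ?yal ?sqrrN.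
pose ga := u2 / al; have ga0 : ga != 0 by rewrite mulf_neq0 ?invr_eq0.
have xga : x ga = ga by rewrite fmorph_div /= xal xu2 invrN mulrNN.
have yga : y ga = - ga by rewrite fmorph_div /= yal yu2 mulNr.
have [b Db] : exists b : F, ga ^+ 2 = b%:A.
  by apply: (gal_fixed_base galL gen); rewrite rmorphXn /= ?xga ?yga ?sqrrN.
have m1 : (-1) ^+ 2 = 1 :> F by rewrite sqrrN expr1n.
have [p [q e]] := eigenvector_norm Da al0 xal yal yB1 xB1 zB1 (expr1n _ 2).
have [p' [q' e']] := eigenvector_norm Da al0 xal yal yB2 xB2 zB2 m1.
have Dap : a = p ^+ 2 - a * q ^+ 2 by apply: (@in_algI _ L); rewrite -Da -e.
have Dbp : b * a = p' ^+ 2 - a * q' ^+ 2.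
  apply: (@in_algI _ L); rewrite -e' -in_algE rmorphM /= -Da -Db.
  by rewrite -exprMn divfK.
have a0 : a != 0.
  by apply: contraNneq al0 => a0; rewrite -sqrf_eq0 Da a0 scale0r.
exists a, b; split; last split.
- have nal : al \notin 1%VS.
    apply/negP=> /vlineP[c Dc]; case/eqP: al0; apply: (eq_opp0 char2).
    by rewrite -xal Dc gal_alg.
  have nga : ga \notin <<1; al>>%VS.
    have al1 : al ^+ 2 \in 1%AS by rewrite Da rpredZ ?mem1v.
    apply/negP=> /(mem_adjoin_sqrt al1)[_ [_ [/vlineP[s ->] /vlineP[t ->] Dg]]].
    case/eqP: ga0; apply: (eq_opp0 char2); rewrite -yga Dg.
    by rewrite rmorphD rmorphM /= !gal_alg yal.
  by exists L, al, ga; split=> //; split=> //; apply: dim_biquadratic Da Db nal nga.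
- exact: quat_split_norm Dap.
(* As [a] and [b * a] are norms, so is [b], which is their product divided by [a ^+ 2]; the
   witnesses are the coordinates of the product of the two elements, divided by [a]. *)
apply: (@quat_split_norm _ a b ((p * p' + a * q * q') / a) ((p * q' + q * p') / a)).
transitivity ((p ^+ 2 - a * q ^+ 2) * (p' ^+ 2 - a * q' ^+ 2) / a ^+ 2).
  by rewrite -Dap -Dbp; field.
by field.
Qed.
End NormEquations.

(** * The [G1]-extension attached to [a] and [b] *)

Section OcticAlgebra.
Variables (K : fieldType) (a b i j g h p : K).
Hypotheses (nz2 : 2%:R != 0 :> K) (a0 : a != 0) (p0 : p != 0) (j0 : j != 0).
Hypotheses (Dai : a = i ^+ 2 - a * j ^+ 2) (Dag : a = g ^+ 2 - b * h ^+ 2).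
Hypothesis Dp : p = i - g * j.
(** This is [(p + al) ^+ 2 - de ^+ 2], the norm of [p + al + de] to [F(al)]: the terms in [al]
    cancel. *)
Let c := p ^+ 2 + a - 2 * p * i.

(* The octic is the product of the ['X^2 - m], for [m] a conjugate of [p + al + de]. *)
Definition octic_coefs : seq K :=
  [:: c ^+ 2; 0; - 4 * p * c; 0; 4 * p ^+ 2 + 2 * c - 4 * a; 0; - 4 * p; 0; 1].

(** Completing the square, [c = (p - i)^2 + a - i^2 = (g^2 - a) j^2]. *)
Lemma octic_const : c = b * (h * j) ^+ 2.
Proof.
have e1 : i ^+ 2 = a + a * j ^+ 2 by rewrite {1}Dai subrK.
have e2 : b * h ^+ 2 = g ^+ 2 - a by rewrite {1}Dag; ring.
rewrite exprMn mulrA e2 /c Dp.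
rewrite (_ : _ + a - _ = a - i ^+ 2 + g ^+ 2 * j ^+ 2); last by ring.
by rewrite e1; ring.
Qed.

(** In this form the octic is a difference of squares, hence a product of two quartics once a square
    root of [a] is available. *)
Lemma octic_eval s : (Poly octic_coefs).[s] =
  ((s ^+ 2 - p) ^+ 2 + a - 2 * p * i) ^+ 2 - 4 * a * s ^+ 4.
Proof. by rewrite horner_Poly /= /c; ring. Qed.

Lemma size_octic : size (Poly octic_coefs) = 9.
Proof. by rewrite (@PolyK _ 0) //= oner_neq0. Qed.

Hypothesis c0 : c != 0.
Variable r : K.
Hypothesis Qr : root (Poly octic_coefs) r.
(** The elements [al] and [de] are recovered from a single root: [(r^2 - p - al)^2 = 2 p (i + al)]
    becomes linear in [al] after replacing [al^2] by [a]. The conjugate [d1] of [de] is fixed by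
    [de * d1 = 2 p j al], because [(i + al)(i - al) = a j^2]. *)
Let al := ((r ^+ 2 - p) ^+ 2 + a - 2 * p * i) / (2 * r ^+ 2).
Let de := r ^+ 2 - p - al.
Let d1 := 2 * p * j * al / de.

Lemma octic_roots :
  [/\ al ^+ 2 = a, de ^+ 2 = 2 * p * (i + al), r ^+ 2 = p + al + de &
   forall s, root (Poly octic_coefs) s ->
    [\/ s ^+ 2 = p + al + de, s ^+ 2 = p + al - de,
        s ^+ 2 = p - al + d1 | s ^+ 2 = p - al - d1]].
Proof.
have r0 : r != 0.
  apply: contraTneq Qr => ->; rewrite rootE octic_eval.
  rewrite (_ : _ - _ = c ^+ 2) ?expf_neq0 //; rewrite /c; ring.
have ala : al ^+ 2 = a.
  have := Qr; rewrite rootE octic_eval subr_eq0 => /eqP e.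
  rewrite /al expr_div_n e; field.
  by rewrite r0 nz2.
have E s : (s ^+ 2 - p - al) ^+ 2 - 2 * p * (i + al) =
    (s ^+ 2 - p) ^+ 2 + a - 2 * p * i - 2 * al * s ^+ 2.
  by rewrite -ala; ring.
have E' s : (s ^+ 2 - p + al) ^+ 2 - 2 * p * (i - al) =
    (s ^+ 2 - p) ^+ 2 + a - 2 * p * i + 2 * al * s ^+ 2.
  by rewrite -ala; ring.
have dE : de ^+ 2 = 2 * p * (i + al).
  apply/eqP; rewrite -subr_eq0 /de E; apply/eqP; rewrite /al; field.
  by rewrite r0 nz2.
have Ni : (i + al) * (i - al) = a * j ^+ 2.
  transitivity (i ^+ 2 - al ^+ 2); first by ring.
  by rewrite ala {1}Dai; ring.
have nN : (i + al) * (i - al) != 0 by rewrite Ni mulf_neq0 ?expf_neq0.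
have ial : i + al != 0 by apply: contraNneq nN => ->; rewrite mul0r.
have de0 : de != 0 by rewrite -sqrf_eq0 dE !mulf_neq0.
have d1E : d1 ^+ 2 = 2 * p * (i - al).
  transitivity (4 * p ^+ 2 * (a * j ^+ 2) / de ^+ 2).
    by rewrite -{1}ala /d1; field.
  by rewrite dE -Ni; field; rewrite ial p0 nz2.
split=> // [|s]; first by rewrite /de; ring.
rewrite rootE octic_eval => /eqP e.
have : ((s ^+ 2 - p - al) ^+ 2 - de ^+ 2) * ((s ^+ 2 - p + al) ^+ 2 - d1 ^+ 2) = 0.
  rewrite dE d1E E E' -[RHS]e -[in 4 * a]ala; ring.
move/eqP; rewrite mulf_eq0 !subr_eq0 !eqf_sqr => /orP[]/orP[]/eqP e1.
- by constructor 1; rewrite -e1; ring.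
- by constructor 2; rewrite -[de]opprK -e1; ring.
- by constructor 3; rewrite -e1; ring.
- by constructor 4; rewrite -[d1]opprK -e1; ring.
Qed.
End OcticAlgebra.

Lemma map_octic (K K' : fieldType) (f : {rmorphism K -> K'}) (a i p : K) :
  map_poly f (Poly (octic_coefs a i p)) = Poly (octic_coefs (f a) (f i) (f p)).
Proof.
rewrite map_Poly; congr Poly.
by rewrite /octic_coefs /= !(rmorph_nat, rmorph0, rmorph1, rmorphN, rmorphXn,
  rmorphB, rmorphD, rmorphM).
Qed.

(** * The Galois group of the octic *)

Section GaloisGroupG1.
Variables (F : fieldType) (char2 : 2%N \notin [pchar F]).
Variables (L : splittingFieldType F) (a b i j p p1 : F).
Variables (al de r0 : L) (rs : seq L).
Hypotheses (galL : galois 1 {:L}) (gen : (<<1 & rs>> = {:L})%VS).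
Hypotheses (nsa : ~ is_sq a) (nsb : ~ is_sq b) (nsab : ~ is_sq (a * b)).
Hypotheses (p0 : p != 0) (j0 : j != 0) (p10 : p1 != 0).
Hypothesis Dai : i ^+ 2 - a = a * j ^+ 2.
Hypotheses (al2 : al ^+ 2 = a%:A) (de2 : de ^+ 2 = 2 * p%:A * (i%:A + al)).
Hypotheses (r02 : r0 ^+ 2 = p%:A + al + de)
           (normde : (p%:A + al) ^+ 2 - de ^+ 2 = (b * p1 ^+ 2)%:A).
Let d1 := 2 * p%:A * j%:A * al / de.
Hypothesis rsP : forall s, s \in rs ->
    [\/ s ^+ 2 = p%:A + al + de, s ^+ 2 = p%:A + al - de,
        s ^+ 2 = p%:A - al + d1 | s ^+ 2 = p%:A - al - d1].
Implicit Types (g h : gal_of {:L}).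

Lemma gal_moved (K : {subfield L}) v : v \notin K ->
  exists g, (forall k, k \in K -> g k = k) /\ g v != v.
Proof.
move=> nKv; apply: NNPP => nex; case/negP: nKv.
have galK : galois K {:L} by apply: galoisS galL; rewrite sub1v subvf.
rewrite -(galois_fixedField galK); apply/fixedFieldP; rewrite ?memvf // => g Kg.
apply/eqP/idPn=> gv; apply: nex; exists g; split=> // k.
exact: (fixed_gal (subvf _) Kg).
Qed.

Lemma gal_sqr g u v : g (u ^+ 2) = v ^+ 2 -> g u = v \/ g u = - v.
Proof.
by rewrite rmorphXn => /eqP; rewrite eqf_sqr => /orP[]/eqP->; [left|right].
Qed.

Let al0 : al != 0.
Proof.
apply/eqP=> e; apply: nsa; exists 0; apply: (@in_algI _ L).
by rewrite -al2 e !expr0n scale0r.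
Qed.

Let normi : (i%:A + al) * (i%:A - al) = (j%:A * al) ^+ 2.
Proof.
rewrite exprMn al2; transitivity ((i%:A : L) ^+ 2 - a%:A); first by rewrite -al2; ring.
by rewrite !exprZn !expr1n -scalerBl Dai mulrC -scalerAl mul1r scalerA.
Qed.

Let pL : p%:A != 0 :> L. Proof. by rewrite scaler_eq0 oner_eq0 orbF. Qed.

Let ial0 : i%:A + al != 0.
Proof.
apply/eqP=> e; have /eqP := normi.
rewrite e mul0r eq_sym sqrf_eq0 mulf_eq0 (negPf al0) orbF.
by rewrite scaler_eq0 oner_eq0 orbF (negPf j0).
Qed.

Let de0 : de != 0.
Proof. by rewrite -sqrf_eq0 de2 !mulf_neq0 ?two_neq0. Qed.

Section Generators.
Variable x : gal_of {:L}.
Hypothesis xal : x al = - al.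
Let d := x de.
Let r1 := x r0.
Let r2 := x r1.
Let r3 := x r2.

Let dd1 : d = d1 \/ d = - d1.
Proof.
apply: (@gal_sqr x de d1).
rewrite de2 !rmorphM rmorph_nat rmorphD /= !gal_alg xal /d1.
transitivity (4 * (p%:A : L) ^+ 2 * ((i%:A + al) * (i%:A - al)) / de ^+ 2).
  by rewrite de2; field; rewrite ial0 pL two_neq0.
by rewrite normi; field.
Qed.

Let d0 : d != 0. Proof. by rewrite fmorph_eq0. Qed.

Let ded : exists2 c : F, de * d = c%:A * al & d = c%:A * al / de.
Proof.
have [->|->] := dd1; rewrite /d1.
  by exists (2 * p * j); rewrite -!in_algE !rmorphM rmorph_nat /=; field.
by exists (- (2 * p * j)); rewrite -!in_algE rmorphN !rmorphM rmorph_nat /=; field.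
Qed.

(** Applying [x] to [de * d = c al] changes the sign of the right side, so [d * x d = - de * d].
    Thus [x] acts on [de] with order 4. *)
Let xd : x d = - de.
Proof.
have [c e _] := ded; apply: (mulfI d0); have := congr1 x e.
by rewrite !rmorphM /= gal_alg xal -/d => ->; rewrite mulrN -e; ring.
Qed.

Let r12 : r1 ^+ 2 = p%:A - al + d.
Proof. by rewrite -rmorphXn /= r02 !rmorphD /= gal_alg xal. Qed.

Let r22 : r2 ^+ 2 = p%:A + al - de.
Proof. by rewrite -rmorphXn /= r12 rmorphD rmorphB /= gal_alg xal xd opprK. Qed.

Let r32 : r3 ^+ 2 = p%:A - al - d.
Proof. by rewrite -rmorphXn /= r22 rmorphB rmorphD /= gal_alg xal. Qed.

Let be := r0 * r2.

Let be2 : be ^+ 2 = (b * p1 ^+ 2)%:A.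
Proof. by rewrite exprMn r02 r22 -normde; ring. Qed.

Let be0 : be != 0.
Proof.
rewrite -sqrf_eq0 be2 scaler_eq0 oner_eq0 orbF mulf_neq0 ?expf_neq0 //.
by apply/eqP=> b0; apply: nsb; exists 0; rewrite b0 expr0n.
Qed.

Let gbe g : g be = be \/ g be = - be.
Proof. by apply: gal_sqr; rewrite be2 gal_alg. Qed.

Let r00 : r0 != 0.
Proof. by apply: contraNneq be0 => e; rewrite /be e mul0r. Qed.

Let r10 : r1 != 0. Proof. by rewrite fmorph_eq0. Qed.
Let r20 : r2 != 0. Proof. by rewrite fmorph_eq0. Qed.

Let r13 : r1 * r3 = be \/ r1 * r3 = - be.
Proof. by have := gbe x; rewrite rmorphM. Qed.

(** Since [x be] is [be] or [- be], [x] applied twice fixes [be], which gives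
    [r2 * x r3 = r0 * r2]. *)
Let xr3 : x r3 = r0.
Proof.
apply: (mulfI r20); rewrite [RHS]mulrC -/be.
have -> : r2 * x r3 = x (x be) by rewrite !rmorphM.
by have [e|e] := gbe x; rewrite e // rmorphN /= e opprK.
Qed.

(** Every root in [rs] has the same square as some [r_k], hence equals it up to sign, and [rs]
    generates [L]. *)
Lemma gal_eq_roots g h : g r0 = h r0 -> g r1 = h r1 -> g r2 = h r2 -> g r3 = h r3 ->
  g = h.
Proof.
move=> e0 e1 e2 e3; apply/eqP/gal_eqP=> v _.
have Lv : v \in <<1 & rs>>%VS by rewrite gen memvf.
apply/eqlfunP; apply: (subvP _ v Lv).
apply/(@Fadjoin_seqP _ _ 1%AS _ (ker_sub_ahom_aspace g h)); split=> [|s rs_s].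
  exact: sub1v.
have sq k : s ^+ 2 = k ^+ 2 -> g k = h k -> s \in ker_sub_ahom_aspace g h.
  move/eqP; rewrite eqf_sqr => /orP[]/eqP-> e; apply/eqlfunP => //.
  by rewrite !rmorphN /= e.
case: (rsP rs_s) => e.
- by apply: (sq r0); rewrite ?e.
- by apply: (sq r2); rewrite ?e.
- by have [ed|ed] := dd1; [apply: (sq r1)|apply: (sq r3)];
    rewrite ?r12 ?r32 ?e ?ed ?opprK.
by have [ed|ed] := dd1; [apply: (sq r3)|apply: (sq r1)];
  rewrite ?r12 ?r32 ?e ?ed ?opprK.
Qed.

Lemma gal_fix_d g : g al = al -> g de = de -> g d = d.
Proof.
by have [c _ ->] := ded; move=> ga gd; rewrite fmorph_div rmorphM /= gal_alg ga gd.
Qed.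

Lemma gal_neg_be : exists y : gal_of {:L}, [/\ y al = al, y de = de & y be = - be].
Proof.
have nbe : be \notin <<1; al>>%VS.
  have nsq c : ~ is_sq c -> ~ is_sq (c * p1 ^+ 2).
    move=> nc [t Dt]; apply: nc; exists (t / p1).
    by rewrite expr_div_n -Dt mulfK ?expf_neq0.
  apply: (sqrt_notin_adjoin char2 al2 be2 nsa); first exact: nsq.
  by rewrite mulrA; apply: nsq.
have [g [fixg mvg]] := gal_moved nbe.
have gal1 : g al = al by apply: fixg; apply: memv_adjoin.
have gbe1 : g be = - be by have [e|//] := gbe g; rewrite e eqxx in mvg.
have [gde|gde] : g de = de \/ g de = - de.
- apply: gal_sqr.
  by rewrite de2 !rmorphM rmorph_nat rmorphD /= !gal_alg gal1.
- by exists g.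
(* If [g] also negates [de], it is corrected by [x ^+ 2], which negates [de] and fixes [al] and
   [be]. *)
exists (x * (x * g))%g; rewrite !galfM; split.
- by rewrite xal rmorphN /= xal opprK.
- by rewrite -/d xd rmorphN /= gde opprK.
rewrite (_ : x (x be) = be) //.
by rewrite rmorphM /= rmorphM /= -/r1 -/r2 -/r3 xr3 mulrC.
Qed.

Variable y : gal_of {:L}.
Hypotheses (yal : y al = al) (yde : y de = de) (ybe : y be = - be).
(** The signs of [y] on [r0] and [r1] are left arbitrary: the relations hold for all choices. As [y]
    negates [r0 * r2] and [r1 * r3], it changes exactly one sign in each of these pairs. *)
Variables s0 s1 : bool.
Hypotheses (yr0 : y r0 = (-1) ^+ s0 * r0) (yr1 : y r1 = (-1) ^+ s1 * r1).

Let yr2 : y r2 = - ((-1) ^+ s0 * r2).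
Proof.
have /(congr1 ( *%R ((-1) ^+ s0))) : y r0 * y r2 = - (r0 * r2) by rewrite -rmorphM.
rewrite yr0 !mulrA -expr2 sqrr_sign mul1r => e; apply: (mulfI r00); rewrite e; ring.
Qed.

Let yr3 : y r3 = - ((-1) ^+ s1 * r3).
Proof.
have /(congr1 ( *%R ((-1) ^+ s1))) : y r1 * y r3 = - (r1 * r3).
  by rewrite -rmorphM /=; have [->|->] := r13; rewrite ?rmorphN /= ybe.
rewrite yr1 !mulrA -expr2 sqrr_sign mul1r => e; apply: (mulfI r10); rewrite e; ring.
Qed.

Let xr : (x r0 = r1) * (x r1 = r2) * (x r2 = r3) * (x r3 = r0).
Proof. by rewrite xr3. Qed.

Let yr := (yr0, yr1, yr2, yr3).

Let galfV g u v : g u = v -> (g^-1)%g v = u.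
Proof. by move <-; rewrite -galfM mulgV gal_id. Qed.

Let xVr := (galfV (erefl r1), galfV (erefl r2), galfV (erefl r3), galfV xr3).

Let x4 : (x ^+ 4 = 1)%g.
Proof. by apply: gal_eq_roots; rewrite !expgS expg0 mulg1 !galfM gal_id !xr. Qed.

Let y2 : (y ^+ 2 = 1)%g.
Proof.
by apply: gal_eq_roots; rewrite expg2 galfM gal_id !yr ?rmorphN /= rmorphMsign /=
  yr ?mulrN ?opprK signrMK.
Qed.

Let yV : (y^-1 = y)%g.
Proof. by apply/eqP; rewrite eq_invg_mul -expg2 y2. Qed.

Local Notation z := [~ x, y]%g.
Local Notation w := [~ z, x]%g.
Let s2 : bool := s0 (+) s1.

Let zE u : z u = y (x (y ((x^-1)%g u))).
Proof. by rewrite /commg /conjg yV !galfM. Qed.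

Let zr : (z r0 = - ((-1) ^+ s2 * r0)) * (z r1 = (-1) ^+ s2 * r1) *
         (z r2 = - ((-1) ^+ s2 * r2)) * (z r3 = (-1) ^+ s2 * r3).
Proof.
do 3?split; rewrite zE xVr yr ?rmorphN /= rmorphMsign /= xr ?rmorphN /=;
  by rewrite rmorphMsign /= yr /s2 signr_addb; ring.
Qed.

Let z2 : (z ^+ 2 = 1)%g.
Proof.
by apply: gal_eq_roots; rewrite expg2 galfM gal_id !zr ?rmorphN /= rmorphMsign /=
  zr ?mulrN ?opprK signrMK.
Qed.

Let zV : (z^-1 = z)%g.
Proof. by apply/eqP; rewrite eq_invg_mul -expg2 z2. Qed.

Let wE u : w u = x (z ((x^-1)%g (z u))).
Proof. by rewrite {1}/commg /conjg zV !galfM. Qed.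

(** [z] changes the signs of one of the pairs [r0, r2] and [r1, r3], and conjugation by [x]
    exchanges the pairs; hence [w], the product of [z] and [z ^ x], changes all four signs. *)
Let wr : (w r0 = - r0) * (w r1 = - r1) * (w r2 = - r2) * (w r3 = - r3).
Proof.
do 3?split; rewrite wE zr ?rmorphN /= rmorphMsign /= xVr ?rmorphN /=;
  by rewrite rmorphMsign /= zr ?mulrN signrMK ?opprK ?rmorphN /= xr.
Qed.

Lemma G1_relations : G1_rel x y.
Proof.
split=> //; last split.
- by apply: gal_eq_roots; rewrite expg2 galfM gal_id !wr rmorphN /= wr opprK.
- by apply: gal_eq_roots; rewrite [LHS]galfM [RHS]galfM !(wr, xr) rmorphN /= xr.
- apply: gal_eq_roots; rewrite [LHS]galfM [RHS]galfM wr yr ?rmorphN /= rmorphMsign;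
  by rewrite /= yr wr ?mulrN.
Qed.

Let xVal : (x^-1)%g al = - al.
Proof. by apply: galfV; rewrite rmorphN /= xal opprK. Qed.

Let zal : z al = al.
Proof. by rewrite zE xVal !rmorphN /= yal xal !rmorphN /= yal opprK. Qed.

Let xVde : (x^-1)%g de = - d.
Proof. by apply: galfV; rewrite rmorphN /= xd opprK. Qed.

Let zde : z de = de.
Proof. by rewrite zE xVde !rmorphN /= gal_fix_d // xd rmorphN /= yde opprK. Qed.

Let zbe : z be = be.
Proof. by rewrite rmorphM /= !zr mulrNN mulrACA -expr2 sqrr_sign mul1r. Qed.

Let wal : w al = al.
Proof. by rewrite wE zal xVal !rmorphN /= zal xal opprK. Qed.

Let wde : w de = de.
Proof. by rewrite wE zde xVde !rmorphN /= gal_fix_d // xd opprK. Qed.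

Let wbe : w be = be.
Proof. by rewrite rmorphM /= !wr mulrNN. Qed.

Let xxal : x (x al) = al.
Proof. by rewrite xal rmorphN /= xal opprK. Qed.

Let zk : z (r0 * r1) = - (r0 * r1).
Proof. by rewrite rmorphM /= !zr mulNr mulrACA -expr2 sqrr_sign mul1r. Qed.

Let wk : w (r0 * r1) = r0 * r1.
Proof. by rewrite rmorphM /= !wr mulrNN. Qed.

Let X := (<[x]> <*> <[y]>)%G.
Let Xx : x \in X. Proof. by rewrite mem_gen // inE cycle_id. Qed.
Let Xy : y \in X. Proof. by rewrite mem_gen // inE cycle_id orbT. Qed.
Let Xz : z \in X. Proof. by rewrite groupR. Qed.
Let Xw : w \in X. Proof. by rewrite groupR. Qed.

(** The chain [genX5] to [genX1] follows the tower obtained by adjoining [al], [de], [be],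
    [r0 * r1], [r0]. An automorphism fixing the earlier elements sends the next one to plus or minus
    itself, and [x], [x ^+ 2], [y], [z], [w] respectively correct the sign. *)
Let genX5 g : g r0 = r0 -> g r1 = r1 -> g be = be -> g \in X.
Proof.
move=> g0 g1 gb; suff -> : g = 1%g by apply: group1.
have g2 : g r2 = r2.
  by apply: (mulfI r00); rewrite -[in LHS]g0 -rmorphM.
apply: gal_eq_roots; rewrite gal_id //; apply: (mulfI r10).
rewrite -[in LHS]g1 -rmorphM /=.
by have [e|e] := r13; rewrite e ?rmorphN /= gb.
Qed.

Let genX4 g : g al = al -> g de = de -> g be = be -> g (r0 * r1) = r0 * r1 ->
  g \in X.
Proof.
move=> ga gd gb gk.
have [g0|g0] : g r0 = r0 \/ g r0 = - r0.
- by apply: gal_sqr; rewrite r02 !rmorphD /= gal_alg ga gd.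
- apply: genX5 => //; apply: (mulfI r00); rewrite -[in LHS]g0 -rmorphM; exact: gk.
have g1 : g r1 = - r1.
  apply: (mulfI r00); rewrite mulrN -gk rmorphM /= g0; ring.
rewrite -(groupMr _ Xw); apply: genX5; rewrite [LHS]galfM.
- by rewrite g0 rmorphN /= wr opprK.
- by rewrite g1 rmorphN /= wr opprK.
- by rewrite gb.
Qed.

Let genX3 g : g al = al -> g de = de -> g be = be -> g \in X.
Proof.
move=> ga gd gb; have [gk|gk] : g (r0 * r1) = r0 * r1 \/ g (r0 * r1) = - (r0 * r1).
- apply: gal_sqr; rewrite exprMn r02 r12 rmorphM !rmorphD rmorphN /= gal_alg.
  by rewrite ga gd gal_fix_d.
- exact: genX4.
rewrite -(groupMr _ Xz); apply: genX4; rewrite [LHS]galfM ?ga ?gd ?gb //.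
by rewrite gk rmorphN /= zk opprK.
Qed.

Let genX2 g : g al = al -> g de = de -> g \in X.
Proof.
move=> ga gd; have [gb|gb] := gbe g; first exact: genX3.
rewrite -(groupMr _ Xy); apply: genX3; rewrite [LHS]galfM ?ga ?gd //.
by rewrite gb rmorphN /= ybe opprK.
Qed.

Let genX1 g : g al = al -> g \in X.
Proof.
move=> ga; have [gd|gd] : g de = de \/ g de = - de.
- apply: gal_sqr.
  by rewrite de2 !rmorphM rmorph_nat rmorphD /= !gal_alg ga.
- exact: genX2.
rewrite -(groupMr _ Xx) -(groupMr _ Xx); apply: genX2; rewrite !galfM ?ga //.
by rewrite gd !rmorphN /= -/d xd opprK.
Qed.

Lemma gal_generated_xy : (<[x]> <*> <[y]> = 'Gal({:L} / 1))%g.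
Proof.
apply/eqP; rewrite eqEsubset; apply/andP; split.
  by apply/subsetP=> g _; apply: gal_in1.
apply/subsetP=> g _; have [ga|ga] : g al = al \/ g al = - al.
- by apply: gal_sqr; rewrite al2 gal_alg.
- exact: genX1.
rewrite -(groupMr _ Xx); apply: genX1.
by rewrite galfM ga rmorphN /= xal opprK.
Qed.

(** Moving an element fixed by [A] keeps [g] out of [<<A>>], so the index is at least 2. *)
Lemma card_gen_step (A : {set gal_of {:L}}) g v :
    (forall h, h \in A -> h v = v) -> g v != v ->
  (2 * #|<<A>>%g| <= #|<<g |: A>>%g|)%N.
Proof.
move=> fixA gv; have sub : <<A>>%g \subset <<g |: A>>%g by rewrite genS ?subsetUr.
rewrite -(Lagrange sub) mulnC leq_mul2l; apply/orP; right.
rewrite indexg_gt1; apply: contra gv => /subsetP/(_ g).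
rewrite mem_gen ?inE ?eqxx // => /(_ isT) Ag.
by rewrite (gal_gen_fix fixA Ag).
Qed.

Let oppr_neq (v : L) : v != 0 -> - v != v.
Proof.
move=> v0; apply: contraNneq v0 => e; apply/eqP/(eq_opp0 char2).
by rewrite e.
Qed.

(** Five doublings along the same tower: [w], [z], [y], [x * x], [x] are added in turn, and each
    negates an element ([r0], [r0 * r1], [be], [de], [al]) fixed by those before it. *)
Lemma card_gal_xy : (32 <= #|<[x]> <*> <[y]>|%g)%N.
Proof.
pose A1 := (w |: set0)%g; pose A2 := (z |: A1)%g; pose A3 := (y |: A2)%g.
pose A4 := ((x * x)%g |: A3)%g; pose A5 := (x |: A4)%g.
have sub : <<A5>>%g \subset X.
  by rewrite gen_subG !subUset !sub1set sub0set groupM Xx ?Xy ?Xz ?Xw.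
have le5 := subset_leq_card sub.
have le4 : (2 * #|<<A4>>%g| <= #|<<A5>>%g|)%N.
  apply: (@card_gen_step _ _ al); last by rewrite xal oppr_neq.
  move=> h; rewrite !inE => /orP[/eqP->|]; first by rewrite galfM.
  by case/or4P=> // /eqP->.
have le3 : (2 * #|<<A3>>%g| <= #|<<A4>>%g|)%N.
  apply: (@card_gen_step _ _ de); last by rewrite galfM -/d xd oppr_neq.
  by move=> h; rewrite !inE => /or4P[] // /eqP->.
have le2 : (2 * #|<<A2>>%g| <= #|<<A3>>%g|)%N.
  apply: (@card_gen_step _ _ be); last by rewrite ybe oppr_neq.
  by move=> h; rewrite !inE => /or3P[] // /eqP->.
have le1 : (2 * #|<<A1>>%g| <= #|<<A2>>%g|)%N.
  apply: (@card_gen_step _ _ (r0 * r1)); last by rewrite zk oppr_neq ?mulf_neq0.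
  by move=> h; rewrite !inE => /orP[] // /eqP->.
have le0 : (2 * #|<<set0 : {set gal_of {:L}}>>%g| <= #|<<A1>>%g|)%N.
  apply: (@card_gen_step _ _ r0); last by rewrite wr oppr_neq.
  by move=> h; rewrite inE.
have gt0 := cardG_gt0 <<set0 : {set gal_of {:L}}>>%G.
apply: leq_trans le5; apply: leq_trans le4; rewrite (_ : 32 = 2 * 16)%N // leq_mul2l /=.
apply: leq_trans le3; rewrite (_ : 16 = 2 * 8)%N // leq_mul2l /=.
apply: leq_trans le2; rewrite (_ : 8 = 2 * 4)%N // leq_mul2l /=.
apply: leq_trans le1; rewrite (_ : 4 = 2 * 2)%N // leq_mul2l /=.
by apply: leq_trans le0; rewrite (_ : 2 = 2 * 1)%N // leq_mul2l /=.
Qed.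
End Generators.

Lemma gal_isog_G1 : isog_G1 ('Gal({:L} / 1%VS))%G.
Proof.
have [x [_ mvx]] := gal_moved (sqrt_notin al2 nsa : al \notin (1%AS : {subfield L})).
have xal : x al = - al.
  have [e|//] : x al = al \/ x al = - al by apply: gal_sqr; rewrite al2 gal_alg.
  by rewrite e eqxx in mvx.
have [y [yal yde ybe]] := gal_neg_be xal.
have sign u : y (u ^+ 2) = u ^+ 2 -> exists s : bool, y u = (-1) ^+ s * u.
  by case/gal_sqr=> ->; [exists false; rewrite mul1r | exists true; rewrite mulN1r].
have [s0 yr0] : exists s : bool, y r0 = (-1) ^+ s * r0.
  by apply: sign; rewrite r02 !rmorphD /= gal_alg yal yde.
have [s1 yr1] : exists s : bool, y (x r0) = (-1) ^+ s * x r0.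
  apply: sign; rewrite -rmorphXn /= r02 !rmorphD /= !gal_alg xal !rmorphN /= yal.
  by rewrite gal_fix_d.
have -> : ('Gal({:L} / 1) = <[x]> <*> <[y]>)%G.
  by apply: val_inj; rewrite /= (gal_generated_xy xal yal yde ybe yr0 yr1).
apply: G1_rel_isog; first exact: (G1_relations xal ybe yr0 yr1).
exact: (card_gal_xy xal yal yde ybe yr0 yr1).
Qed.
End GaloisGroupG1.

Lemma G1_extension_exists (F : fieldType) (a b i j g h : F) :
    2%N \notin [pchar F] -> ~ is_sq a -> ~ is_sq b -> ~ is_sq (a * b) ->
    a = i ^+ 2 - a * j ^+ 2 -> a = g ^+ 2 - b * h ^+ 2 -> i - g * j != 0 ->
  exists L : splittingFieldType F,
    galois 1 {:L} /\ isog_G1 ('Gal({:L} / 1%VS))%G.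
Proof.
move=> char2 nsa nsb nsab Dai Dag; set p := i - g * j => p0.
have nz (c : F) : ~ is_sq c -> c != 0.
  by move=> nc; apply/eqP=> c0; apply: nc; exists 0; rewrite c0 expr0n.
have j0 : j != 0.
  by apply/eqP=> e; apply: nsa; exists i; rewrite {1}Dai e; ring.
have h0 : h != 0.
  by apply/eqP=> e; apply: nsa; exists g; rewrite {1}Dag e; ring.
have Q0 : Poly (octic_coefs a i p) != 0 by rewrite -size_poly_gt0 size_octic.
have [L [rs Dq gen]] := splitting_field_exists Q0.
pose f := in_alg L.
have fQ := map_octic f a i p.
have fz c : c != 0 -> f c != 0 by rewrite fmorph_eq0.
have DaiL : f a = f i ^+ 2 - f a * f j ^+ 2.
  by rewrite -!rmorphXn -rmorphM -rmorphB -Dai.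
have DagL : f a = f g ^+ 2 - f b * f h ^+ 2.
  by rewrite -!rmorphXn -rmorphM -rmorphB -Dag.
have Dp : f p = f i - f g * f j by rewrite -rmorphM -rmorphB.
have cE := octic_const DaiL DagL Dp.
have c0 : f p ^+ 2 + f a - 2 * f p * f i != 0.
  rewrite cE; apply: mulf_neq0; first exact/fz/nz.
  by apply: expf_neq0; apply: mulf_neq0; apply: fz.
have rootE s : root (Poly (octic_coefs (f a) (f i) (f p))) s = (s \in rs).
  by rewrite -fQ (eqp_root Dq) root_prod_XsubC.
have [r0 rs0] : exists r0, r0 \in rs.
  have := eqp_size Dq; rewrite size_map_poly size_octic size_prod_XsubC.
  by case: (rs) => // r s _; exists r; rewrite mem_head.
have nz2 := two_neq0 L char2.
have Qr : root (Poly (octic_coefs (f a) (f i) (f p))) r0 by rewrite rootE.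
have := octic_roots nz2 (fz _ (nz _ nsa)) (fz _ p0) (fz _ j0) DaiL c0 Qr.
set al := _ / _; set de := _ - _; case=> al2 de2 r02 rsP.
have normde : (f p + al) ^+ 2 - de ^+ 2 = f (b * (h * j) ^+ 2).
  have -> : f (b * (h * j) ^+ 2) = f b * (f h * f j) ^+ 2.
    by rewrite -rmorphM -rmorphXn -rmorphM.
  by rewrite de2 -cE -al2; ring.
have K1 c : f c \in (1%AS : {subfield L}) by rewrite rpredZ ?mem1v.
have Kf (K : {subfield L}) c : f c \in K by rewrite (subvP (sub1v K)).
have Kn (K : {subfield L}) : 2%:R \in K by rewrite rpredMn ?mem1v.
have KM (K : {subfield L}) u v : u \in K -> v \in K -> u * v \in K by apply: rpredM.
(* Separability needs no discriminant: [L] is reached by adjoining [al], [de] and then the roots,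
   each a square root over the field before it, and the characteristic is not 2. *)
have galL : galois 1 {:L}.
  rewrite /galois sub1v normalFieldf andbT.
  have sep1 : separable 1 <<1; al>>.
    rewrite -(@adjoin_separable_eq _ _ 1%AS) separable_adjoin_sqrt //.
    by rewrite al2.
  have Kal : al \in <<1; al>>%AS by apply: memv_adjoin.
  have sep2 : separable <<1; al>> << <<1; al>>; de>>.
    rewrite -(@adjoin_separable_eq _ _ <<1; al>>%AS) separable_adjoin_sqrt //.
    have K2p : 2 * f p \in <<1; al>>%AS by rewrite rpredM ?Kn ?Kf.
    have Ki : f i + al \in <<1; al>>%AS by rewrite rpredD ?Kf.
    by rewrite de2 rpredM.
  set K2 := << <<1; al>>; de>>%AS in sep2.
  have K2al : al \in K2 by apply: subvP_adjoin.
  have K2de : de \in K2 by apply: memv_adjoin.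
  have sep3 : separable K2 <<K2 & rs>>.
    apply: separable_Fadjoin_seq; apply/allP=> s rs_s.
    apply: separable_adjoin_sqrt => //; have := rs_s; rewrite -rootE.
    have K2V : de^-1 \in K2 by rewrite rpredV.
    have Kd := KM _ _ _ (KM _ _ _ (KM _ _ _ (KM _ _ _ (Kn K2) (Kf K2 p)) (Kf K2 j))
      K2al) K2V.
    have Kp1 : f p + al \in K2 by rewrite rpredD ?Kf.
    have Kp2 : f p - al \in K2 by rewrite rpredB ?Kf.
    by case/rsP=> ->; [apply: rpredD | apply: rpredB | apply: rpredD | apply: rpredB].
  have full : <<K2 & rs>>%VS = fullv.
    have sub := adjoin_seqSl rs (sub1v K2); rewrite gen in sub.
    by apply/eqP; rewrite eqEsubv subvf.
  rewrite full in sep3.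
  exact: separable_trans sep1 (separable_trans sep2 sep3).
exists L; split=> //.
have Dai' : i ^+ 2 - a = a * j ^+ 2 by rewrite {1}Dai; ring.
have h1 : h * j != 0 by rewrite mulf_neq0.
apply: (gal_isog_G1 char2 galL gen nsa nsb nsab p0 j0 h1 Dai' al2 de2 r02 normde).
by move=> s; rewrite -rootE; apply: rsP.
Qed.

(** * The equivalences *)

Lemma injm_mem_gen2 (aT rT : finGroupType) (D : {group aT})
    (f : {morphism D >-> rT}) (u v t : aT) :
    ('injm f)%g -> u \in D -> v \in D -> t \in D ->
  f t \in <<[set f u; f v]>>%g -> t \in <<[set u; v]>>%g.
Proof.
move=> injf Du Dv Dt; have sub : [set u; v] \subset D by rewrite subUset !sub1set Du.
have -> : (<<[set f u; f v]>> = f @* <<[set u; v]>>)%g.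
  by rewrite morphim_gen // morphimU !morphim_set1.
by case/morphimP=> k Dk Ak /(injmP injf)->.
Qed.

Section Equivalences.
Variables (F : fieldType) (char2 : 2%N \notin [pchar F]).
Implicit Types a b c : F.

Lemma DC_extension_norms (L : splittingFieldType F) :
    galois 1 {:L} -> isog_DC ('Gal({:L} / 1%VS))%g ->
  exists a b, biquadratic_deg4 a b /\ quat_split a a /\ quat_split a b.
Proof.
move=> galL [lam [kerV iso]].
have [X [Y [[genXY X4 Y2 Z2 ZX] [n1 n2]]]] := DC_pullback_generators kerV.
move: iso; rewrite -genXY isog_sym => /isogP[f injf imf].
pose P := (<[X]> <*> <[Y]>)%G.
have PX : X \in P by rewrite mem_gen // inE cycle_id.
have PY : Y \in P by rewrite mem_gen // inE cycle_id orbT.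
have PZ : [~ X, Y]%g \in P by rewrite groupR.
have fZ : [~ f X, f Y]%g = f [~ X, Y]%g by rewrite morphR.
have fX2 : (f X ^+ 2)%g = f (X ^+ 2)%g by rewrite morphX.
have gen : (<[f X]> <*> <[f Y]> = 'Gal({:L} / 1))%g.
  by rewrite -imf morphimY ?cycle_subG // !morphim_cycle.
have x4 : (f X ^+ 4 = 1)%g by rewrite -morphX // X4 morph1.
have z2 : ([~ f X, f Y] ^+ 2 = 1)%g by rewrite fZ -morphX // Z2 morph1.
have zx : [~ f X, f Y, f X]%g = 1%g by rewrite fZ -morphR // ZX morph1.
apply: (norm_equations char2 galL gen x4 z2 zx); rewrite fZ fX2.
  by apply: contra n1; apply: (injm_mem_gen2 injf PY PZ (groupX 2 PX)).
rewrite -morphM ?groupX //; apply: contra n2.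
exact: (injm_mem_gen2 injf PY (groupM (groupX 2 PX) PZ) (groupX 2 PX)).
Qed.

(** The generators of the pullback satisfy the relations of [G1], with [[~ X, Y, X]] trivial, so the
    pullback is a quotient of the given Galois group. *)
Lemma G1_extension_DC (L : splittingFieldType F) :
    galois 1 {:L} -> isog_G1 ('Gal({:L} / 1%VS))%G ->
  exists L' : splittingFieldType F,
    galois 1 {:L'} /\ isog_DC ('Gal({:L'} / 1%VS))%g.
Proof.
move=> galL isoG1; have [lam kerV] := D8_to_Z2_exists.
have [X [Y [[genXY X4 Y2 Z2 ZX] _]]] := DC_pullback_generators kerV.
have hom : ((<[X]> <*> <[Y]>)%G \homg 'Gal({:L} / 1))%g.
  rewrite isoG1; apply/G1_homgP; exists X, Y; split=> //.
  split=> //; rewrite ZX ?expg1n //.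
  by split; apply/commute_sym/commute1.
have [L' [galL' iso]] := galois_quotient galL hom.
by exists L'; split=> //; exists lam; split=> //; rewrite -genXY.
Qed.

Lemma norms_G1_extension a b : biquadratic_deg4 a b -> quat_split a a ->
    quat_split a b ->
  exists L : splittingFieldType F, galois 1 {:L} /\ isog_G1 ('Gal({:L} / 1%VS))%G.
Proof.
case/(biquadratic_deg4P char2)=> nsa nsb nsab.
case/(quat_split_isnorm nsa)=> i [j Dai].
(* The arguments are exchanged because the construction uses [a] as a norm from [F(sqrt b)]. *)
case/quat_split_sym/(quat_split_isnorm nsb)=> g [h Dag].
have [e|nz] := eqVneq (i - g * j) 0; last first.
  exact: (G1_extension_exists char2 nsa nsb nsab Dai Dag nz).
apply: (@G1_extension_exists F a b i j (- g) h) => //; first by rewrite sqrrN.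
apply/eqP=> e'.
(* If both signs of [g] fail then [i = g = 0], and [-1 = j ^+ 2]. *)
have j0 : j != 0.
  by apply/eqP=> j0; apply: nsa; exists i; rewrite {1}Dai j0; ring.
have i0 : i = 0.
  have : 2 * i = (i - g * j) + (i - - g * j) by ring.
  by rewrite e e' addr0 => /eqP; rewrite mulf_eq0 (negPf (pchar2_neq0 char2)) => /eqP.
have g0 : g = 0.
  by move/eqP: e; rewrite i0 sub0r oppr_eq0 mulf_eq0 (negPf j0) orbF => /eqP.
apply: nsab; exists (b * h * j).
transitivity (- (b * h ^+ 2) * b * (- j ^+ 2)); last by ring.
have <- : a = - (b * h ^+ 2) by rewrite {1}Dag g0; ring.
have a0 : a != 0.
  by apply/eqP=> a0; apply: nsa; exists 0; rewrite a0 expr0n.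
have -> : - j ^+ 2 = 1 by apply: (mulfI a0); rewrite [in RHS]Dai i0; ring.
by rewrite mulr1.
Qed.

Let nz2 : 2%:R != 0 :> F. Proof. exact: pchar2_neq0. Qed.

Let nz4 : 4%:R != 0 :> F. Proof. by rewrite (natrM F 2 2) mulf_neq0. Qed.

Lemma not_sq_neq0 c : ~ is_sq c -> c != 0.
Proof. by move=> nc; apply/eqP=> c0; apply: nc; exists 0; rewrite c0 expr0n. Qed.

Lemma not_sq_mul c d e : c != 0 -> d = c ^+ 2 * e -> ~ is_sq e -> ~ is_sq d.
Proof.
move=> c0 -> ne [t Dt]; apply: ne; exists (t / c).
by rewrite expr_div_n -Dt mulrC mulKf ?expf_neq0.
Qed.

Lemma same_sqclass_mul c x y : c != 0 -> x != 0 -> y != 0 ->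
  is_sq (c * x) -> is_sq (c * y) -> same_sqclass x y.
Proof.
move=> c0 x0 y0 [t Dt] [u Du].
have u0 : u != 0 by rewrite -sqrf_eq0 -Du mulf_neq0.
have t0 : t != 0 by rewrite -sqrf_eq0 -Dt mulf_neq0.
exists (t / u); split; first by rewrite mulf_neq0 ?invr_eq0.
by rewrite expr_div_n -Dt -Du; field; rewrite y0 c0.
Qed.

(** The equation reads [a (1 + j^2) = i^2], so [a] is a square times [1 + j^2], unless the latter
    vanishes. *)
Lemma norm_sum_two_squares a i j :
  a != 0 -> a = i ^+ 2 - a * j ^+ 2 -> DF2 1 a.
Proof.
move=> a0 Dai; split=> //; have e : a * (1 + j ^+ 2) = i ^+ 2.
  by rewrite mulrDr mulr1 {1}Dai; ring.
have [j1|nz] := eqVneq (1 + j ^+ 2) 0.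
  (* Here [j^2 = -1], and [a] is the difference of the squares of [(a + 1)/2] and [(a - 1)/2]. *)
  exists ((a + 1) / 2), (j * (a - 1) / 2).
  have jj : j ^+ 2 = -1 by apply/eqP; rewrite -addr_eq0 addrC j1.
  transitivity ((a + 1) ^+ 2 / 2 ^+ 2 + j ^+ 2 * ((a - 1) ^+ 2 / 2 ^+ 2));
    last by field; rewrite ?nz2 ?nz4.
  by rewrite jj; field; rewrite ?nz2 ?nz4.
exists (i / (1 + j ^+ 2)), (i * j / (1 + j ^+ 2)).
transitivity (i ^+ 2 / (1 + j ^+ 2)); last by field.
by rewrite -e mulfK.
Qed.

(** The classes are those of 1, [a], [b], [a b]: all are norms, and the product of two different
    ones is [a], [b] or [a b] up to a square. *)
Lemma four_classes a b : DF2 1 a -> ~ is_sq a -> ~ is_sq b -> ~ is_sq (a * b) ->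
    DF2 (- a) b ->
  exists a, DF2 1 a /\ ~ is_sq a /\ exists s : 'I_4 -> F,
    (forall i, DF2 (- a) (s i)) /\
    (forall i j, i != j -> ~ same_sqclass (s i) (s j)).
Proof.
move=> Da nsa nsb nsab Db; exists a; do 2!split=> //.
have a0 := not_sq_neq0 nsa; have b0 := not_sq_neq0 nsb.
exists (fun i => nth 0 [:: 1; a; b; a * b] i); split.
  have Daa := sum_two_squares_norm nsa Da.
  case=> -[|[|[|[|//]]]] ? /=; [|exact: Daa|exact: Db|exact: DF2_norm_mul].
  by split; [apply: oner_neq0 | exists 1, 0; ring].
have sqM x y : same_sqclass x y -> is_sq (x * y).
  by case=> t [_ ->]; exists (t * y); ring.
have n1 := oner_neq0 F.
case=> -[|[|[|[|//]]]] ? [[|[|[|[|//]]]] ?] //= _ /sqM.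
all: by first [ apply: (not_sq_mul n1 _ nsa); ring | apply: (not_sq_mul n1 _ nsb); ring
  | apply: (not_sq_mul n1 _ nsab); ring | apply: (not_sq_mul a0 _ nsb); ring
  | apply: (not_sq_mul b0 _ nsa); ring ].
Qed.

(** Otherwise each [s i] lies in the class of 1 or of [a], and already three indices would give a
    repetition. *)
Lemma new_class a (s : 'I_4 -> F) : ~ is_sq a ->
    (forall i, DF2 (- a) (s i)) ->
    (forall i j, i != j -> ~ same_sqclass (s i) (s j)) ->
  exists b, [/\ DF2 (- a) b, ~ is_sq b & ~ is_sq (a * b)].
Proof.
move=> nsa Ds dist; apply: NNPP => nex.
have a0 := not_sq_neq0 nsa; have s0 i : s i != 0 by case: (Ds i).
have P i : is_sq (1 * s i) \/ is_sq (a * s i).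
  rewrite mul1r; apply: NNPP => /not_or_and[n1 n2].
  by apply: nex; exists (s i).
have n1 := oner_neq0 F.
have D c i j : c != 0 -> i != j -> is_sq (c * s i) -> is_sq (c * s j) -> False.
  by move=> c0 ij si sj; apply: (dist i j ij); apply: same_sqclass_mul si sj.
pose o k : 'I_4 := inord k.
have od k l : (k < 4)%N -> (l < 4)%N -> k != l -> o k != o l.
  by move=> k4 l4; rewrite -val_eqE /= !inordK.
have d01 : o 0%N != o 1%N by apply: od.
have d02 : o 0%N != o 2 by apply: od.
have d12 : o 1%N != o 2 by apply: od.
have [p0|p0] := P (o 0%N); have [p1|p1] := P (o 1%N); have [p2|p2] := P (o 2).
- exact: (D 1 _ _ n1 d01 p0 p1).
- exact: (D 1 _ _ n1 d01 p0 p1).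
- exact: (D 1 _ _ n1 d02 p0 p2).
- exact: (D a _ _ a0 d12 p1 p2).
- exact: (D 1 _ _ n1 d12 p1 p2).
- exact: (D a _ _ a0 d02 p0 p2).
- exact: (D a _ _ a0 d01 p0 p1).
- exact: (D a _ _ a0 d01 p0 p1).
Qed.

(** [x = u^2 + v^2] gives [- v^2 = u^2 - x]; divide by [v^2]. *)
Lemma neg_one_norm (x : F) : DF2 1 x -> ~ is_sq x -> DF2 (- x) (-1).
Proof.
case=> x0 [u [v Dx]] nsx; split; first by rewrite oppr_eq0 oner_neq0.
have v0 : v != 0 by apply/eqP=> v0; apply: nsx; exists u; rewrite Dx v0; ring.
by exists (u / v), v^-1; rewrite Dx; field.
Qed.

(** The element [- x] is not rigid: [<1, -x>] represents -1, which is neither a square nor [- x]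
    times a square. *)
Lemma not_rigid_of_sum (x : F) : DF2 1 x -> ~ is_sq x -> ~ is_sq (- x) ->
  ~ is_sq (-1 : F) -> ~ rigid_field F.
Proof.
move=> Dx nsx nsNx ns1 rig; have := neg_one_norm Dx nsx.
case/(rig (- x) (not_sq_neq0 nsNx) nsNx) => [|t [t0 [e|e]]]; first by rewrite opprK.
  by apply: ns1; exists t.
apply: nsx; exists t^-1; rewrite exprVn; apply: (mulIf (expf_neq0 2 t0)).
by rewrite mulVf ?expf_neq0 // -[LHS]opprK -mulNr -e opprK.
Qed.
End Equivalences.

Theorem theorem3p7 (F : fieldType) (char2 : 2%N \notin [pchar F]) :
  let P1 := exists L : splittingFieldType F,
              galois 1%VS {:L} /\ isog_DC ('Gal({:L} / 1%VS))%g in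
  let P2 := exists L : splittingFieldType F,
              galois 1%VS {:L} /\ isog_G1 ('Gal({:L} / 1%VS))%g in
  let P3 := exists a b : F,
              biquadratic_deg4 a b /\ quat_split a a /\ quat_split a b in
  let P4 := exists a : F,
              DF2 1 a /\ ~ is_sq a /\
              exists s : 'I_4 -> F,
                (forall i, DF2 (- a) (s i)) /\
                (forall i j, i != j -> ~ same_sqclass (s i) (s j)) in
  let P5 := ~ rigid_field F /\
              exists x : F, DF2 1 x /\ ~ is_sq x /\ ~ is_sq (- x) in
  let P6 := (is_sq (-1 : F) /\ ~ rigid_field F) \/
            (~ is_sq (-1 : F) /\
              exists x : F, DF2 1 x /\ ~ is_sq x /\ ~ is_sq (- x)) in
  [<-> P1; P2; P3; P4; P5; P6] /\
  (formally_real F -> (P1 <-> ~ pythagorean F)).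
Proof.
move=> P1 P2 P3 P4 P5 P6.
(* Two cycles, [P1], [P3], [P2] and [P4], [P5], [P6], are linked by the equivalence of [P3] and
   [P4]. *)
have P13 : P1 -> P3 by case=> L [galL iso]; apply: (DC_extension_norms char2 galL iso).
have P32 : P3 -> P2.
  by case=> a [b [deg4 [aa ab]]]; apply: (norms_G1_extension char2 deg4 aa ab).
have P21 : P2 -> P1 by case=> L [galL iso]; apply: (G1_extension_DC galL iso).
have P34 : P3 -> P4.
  case=> a [b [/(biquadratic_deg4P char2)[nsa nsb nsab] [aa ab]]].
  have [i [j Dai]] := quat_split_isnorm nsa aa.
  have [m [n Db]] := quat_split_isnorm nsa ab.
  have Da := norm_sum_two_squares char2 (not_sq_neq0 nsa) Dai.
  apply: (four_classes Da nsa nsb nsab); split; first exact: not_sq_neq0.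
  by exists m, n; rewrite mulNr.
have P43 : P4 -> P3.
  case=> a [Da [nsa [s [Ds dist]]]].
  have [b [[_ [m [n Db]]] nsb nsab]] := new_class nsa Ds dist.
  have [_ [i [j Dai]]] := sum_two_squares_norm nsa Da.
  exists a, b; split; first by apply/(biquadratic_deg4P char2).
  by split; [apply: (quat_split_norm (m := i) (n := j))
            | apply: (quat_split_norm (m := m) (n := n))]; rewrite -mulNr.
have P45 : P4 -> P5.
  case=> a [Da [nsa [s [Ds dist]]]].
  have [b [Db nsb nsab]] := new_class nsa Ds dist.
  have a0 := not_sq_neq0 nsa; have b0 := not_sq_neq0 nsb.
  (* If [- a] is a square, [<1, -a>] represents the same elements as [<1, 1>], and [b] is the
     required sum of two squares; otherwise [a] is. *)
  have [[t Dt]|nsNa] := classic (is_sq (- a)).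
    have t0 : t != 0 by rewrite -sqrf_eq0 -Dt oppr_eq0.
    have aE : a = - t ^+ 2 by rewrite -Dt opprK.
    have ns1 : ~ is_sq (-1 : F).
      by case=> k Dk; apply: nsa; exists (k * t); rewrite exprMn -Dk aE; ring.
    have D1b : DF2 1 b.
      by case: Db => _ [u [v e]]; split=> //; exists u, (t * v); rewrite e Dt; ring.
    have nsNb : ~ is_sq (- b).
      by case=> k Dk; apply: nsab; exists (t * k); rewrite exprMn -Dk aE; ring.
    by split; [apply: (not_rigid_of_sum D1b nsb nsNb ns1) | exists b].
  split; last by exists a.
  move=> rig; have nsNNa : ~ is_sq (- - a) by rewrite opprK.
  have {}rig := rig (- a) (not_sq_neq0 nsNa) nsNa nsNNa.
  (* Rigidity of [- a] puts the nonsquare norms [a] and [b] both in the class of [- a], so their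
     product is a square. *)
  have [t [t0 [e|e]]] := (rig a).1 (sum_two_squares_norm nsa Da).
    by apply: nsa; exists t.
  have [k [k0 [e'|e']]] := (rig b).1 Db; first by apply: nsb; exists k.
  apply: nsab; exists (a * (t * k)); rewrite e' {2}e; ring.
have P56 : P5 -> P6.
  by case=> nrig sum; have [sq|nsq] := classic (is_sq (-1 : F)); [left|right].
have P64 : P6 -> P4.
  (* If -1 is not a square, the pair [x], -1 gives the four classes. If it is, the pair is [- c],
     [d], where the value [d] of [<1, c>] witnesses that [c] is not rigid. *)
  case=> [[[k Dk] nrig] | [ns1 [x [Dx [nsx nsNx]]]]]; last first.
    apply: (four_classes Dx nsx ns1); first by rewrite mulrN1.
    exact: neg_one_norm.
  have [c [c0 [nsc [nsNc nrc]]]] :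
      exists c : F, c != 0 /\ ~ is_sq c /\ ~ is_sq (- c) /\ ~ rigid_elt c.
    apply: NNPP => nex; apply: nrig => c c0 nsc nsNc; apply: NNPP => nrc.
    by apply: nex; exists c.
  have [d [Dd nd]] : exists d, DF2 c d /\
      ~ exists t : F, t != 0 /\ (d = t ^+ 2 \/ d = c * t ^+ 2).
    apply: NNPP => nex; apply: nrc => d; split.
      by move=> Dd; apply: NNPP => nd; apply: nex; exists d.
    case=> t [t0 [->|->]]; split; rewrite ?mulf_neq0 ?expf_neq0 //.
      by exists t, 0; ring.
    by exists 0, t; ring.
  have d0 : d != 0 by case: Dd.
  have nsd : ~ is_sq d.
    by case=> t Dt; apply: nd; exists t; split; [rewrite -sqrf_eq0 -Dt | left].
  have nscd : ~ is_sq (- c * d).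
    case=> t Dt; have t0 : t != 0 by rewrite -sqrf_eq0 -Dt mulf_neq0 ?oppr_eq0.
    have k0 : k != 0 by rewrite -sqrf_eq0 -Dk oppr_eq0 oner_neq0.
    apply: nd; exists (k * t / c); split; first by rewrite !mulf_neq0 ?invr_eq0.
    right; transitivity (c * (k ^+ 2 * t ^+ 2 / c ^+ 2)); last by field.
    by rewrite -Dt -Dk; field.
  have DNc : DF2 1 (- c).
    apply: (@norm_sum_two_squares F char2 (- c) 0 k); first by rewrite oppr_eq0.
    by rewrite -Dk; ring.
  by apply: (four_classes DNc nsNc nsd nscd); rewrite opprK.
split; first by tfae=> [/P13/P32|/P21/P13| | | |/P64/P43/P32/P21].
move=> real; have P16 : P1 <-> P6.
  by split=> [/P13/P34/P45/P56 | /P64/P43/P32/P21].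
(* This excludes the first alternative of [P6], and also that a nonzero sum of two squares is the
   negative of a square; what remains of [P6] is a sum of two squares that is not a square. *)
have no_sum1 (u v : F) : u ^+ 2 + v ^+ 2 != -1.
  apply/eqP=> e; apply: real; exists 2, (fun i => nth 0 [:: u; v] i).
  by rewrite !big_ord_recl big_ord0 /= addr0.
have ns1 : ~ is_sq (-1 : F).
  case=> t Dt; have := no_sum1 t 0; by rewrite expr0n addr0 -Dt eqxx.
rewrite P16; split=> [[[]//|[_ [x [[x0 [u [v Dx]]] [nsx _]]]]] pyth | npyth].
  by apply: nsx; rewrite Dx mul1r.
right; split=> //; apply: NNPP => nex; apply: npyth => u v; apply: NNPP => nsq.
apply: nex; exists (u ^+ 2 + v ^+ 2); split; last split=> //.
  by split; [apply: not_sq_neq0 | exists u, v; rewrite mul1r].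
case=> t Dt; have t0 : t != 0.
  by rewrite -sqrf_eq0 -Dt oppr_eq0 not_sq_neq0.
have /eqP[] := no_sum1 (u / t) (v / t).
by rewrite !expr_div_n -mulrDl -[X in X / _]opprK Dt mulNr mulfV ?expf_neq0.
Qed.
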